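(* Let $B=\{B(t):t\in\mathbb{R}\}$ be a standard (two-sided) Brownian motion with $B(0)=0$, let $Y(t)=B(t)-t$, $Q(t)=\sup_{s\le t}(Y(t)-Y(s))$ for $t\ge0$, and $M(t)=\inf_{s\in[0,t]}Q(s)$. Then for each $t>0$ and each $u>0$, \[ \mathbb{P}(M(t)>u)=e^{-2u}\left(2(1+t)\,\Psi(\sqrt t)-\sqrt{\frac{2t}{\pi}}\;e^{-t/2}\right), \] where $\Psi(x)=\mathbb{P}(\mathcal N>x)$ for a standard normal random variable $\mathcal N$.
   Context: The supremum defining $Q(t)$ is over all real $s\le t$, so that $Q$ is a stationary process (stationary reflected Brownian motion with drift $-1$). *)

(* Defs.v *)
From HB Require Import structures.
From mathcomp Require Import all_boot all_order all_algebra.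
From mathcomp Require Import all_classical all_reals all_analysis.
Set Implicit Arguments.
Unset Strict Implicit.
Unset Printing Implicit Defensive.
Import Order.TTheory GRing.Theory Num.Theory.
Import numFieldNormedType.Exports.
Local Open Scope classical_set_scope.
Local Open Scope ring_scope.

(* For a finite family, the product rule for subfamilies is the case where the
   remaining [A i] are [setT]. *)
Definition mutually_independent (d : measure_display) (T : measurableType d)
    (R : realType) (P : probability T R) (n : nat)
    (X : 'I_n -> T -> R) : Prop :=
  forall A : 'I_n -> set R, (forall i, measurable (A i)) ->
    P [set w | forall i, A i (X i w)] = (\prod_(i < n) P (X i @^-1` A i))%E.

(* [normal_prob] takes the standard deviation, not the variance. *)
Record two_sided_brownian_motion (d : measure_display) (T : measurableType d)
    (R : realType) (P : probability T R) (B : R -> {RV P >-> R}) : Prop := {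
  bm_start : forall w, B 0 w = 0;
  bm_independent_increments :
    forall (n : nat) (t : nat -> R), {homo t : i j / (i <= j)%N >-> i <= j} ->
      mutually_independent P (fun i : 'I_n => B (t i.+1) \- B (t i));
  bm_gaussian_increments :
    forall s t : R, s < t -> forall A : set R, measurable A ->
      P ((B t \- B s) @^-1` A) = normal_prob 0 (Num.sqrt (t - s)) A;
  bm_continuous_paths : forall w, continuous (fun t => B t w) }.

Definition drifted (d : measure_display) (T : measurableType d) (R : realType)
    (P : probability T R) (B : R -> {RV P >-> R}) (t : R) (w : T) : R :=
  B t w - t.

(* Extended-real-valued: the supremum is finite only almost surely. *)
Definition reflected (d : measure_display) (T : measurableType d) (R : realType)
    (P : probability T R) (B : R -> {RV P >-> R}) (t : R) (w : T) : \bar R :=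
  ereal_sup [set (drifted B t w - drifted B s w)%:E | s in `]-oo, t]].

Definition reflected_min (d : measure_display) (T : measurableType d)
    (R : realType) (P : probability T R) (B : R -> {RV P >-> R})
    (t : R) (w : T) : \bar R :=
  ereal_inf [set reflected B s w | s in `[0, t]].

Definition normal_tail (R : realType) (x : R) : R :=
  fine (normal_prob (0 : R) 1 `]x, +oo[).

(* Main.v *)
Require Import Defs.
From HB Require Import structures.
From mathcomp Require Import all_boot all_order all_algebra.
From mathcomp Require Import all_classical all_reals all_analysis.
From mathcomp Require Import measurable_realfun ring lra.
Set Implicit Arguments.
Unset Strict Implicit.
Unset Printing Implicit Defensive.
Import Order.TTheory GRing.Theory Num.Theory.
Import numFieldNormedType.Exports.
Local Open Scope classical_set_scope.
Local Open Scope ring_scope.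

(** If Q > u > 0 on [0, t], then at a minimum of Y on [0, t] the supremum defining
    Q is not reached after time 0.  Hence the event is {Q(0) - M > u} with
    M = sup_[0, t] (-Y) independent of Q(0); both are limits of maxima of drifted
    random walks along dyadic grids.  The exponential martingale exp(2x) gives
    P(Q(0) > x) = exp(-2x), so that the probability is exp(-2u) E exp(-2M).
    For M, let V(s, x) be the mean of g(x - S), where S is normal with mean and
    variance s, and g(z) is 1 for z > 0, 0 for z = 0 and -exp(2z) for z < 0.
    Reflection shows that V(s, x) has the sign of x, and a first-step induction
    then traps P(M <= x) along a grid of n steps between V(t, x) and V(t, x + e),
    up to n P(step > e): the shift by e absorbs the overshoot.  Integrating
    against 2 exp(-2x) dx evaluates E exp(-2M). *)

(** * Normal and exponential integrals *)

(** The distributional hypotheses concern finitely many increments, so first-passage arguments are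
    run on random walks, where induction on the first step replaces stopping at the passage time.
    The function g is an image construction: exp(-z) g(z) is odd, and this weight compensates the
    drift of a normal variable whose mean equals its variance, so that V vanishes at x = 0. A walk
    jumps over a level instead of hitting it; hence only the sign of V on either side of 0 is used.
    The law of M is never put in closed form: E exp(-2M) is the probability that M is at most an
    independent exponential variable of rate 2, and the corresponding average of V depends only on
    the law of the total sum, whatever the mesh. The two grids are refined separately. The event
    asks for one past time that serves all future times, so it is an increasing union over past
    grids of decreasing intersections over future grids; a margin 1/(m+1) keeps the inequality
    strict under the intersection. A grid of index m has at most 4^m steps, while the chance that a
    step exceeds a fixed e decays exponentially in 2^m. Grids are therefore refined with e fixed,
    and e tends to 0 last. *)

Section change_of_variables.
Context {R : realType}.
Notation mu := (@lebesgue_measure R).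

Lemma ge0_integral_affine (a b : R) (f : R -> \bar R) : 0 < a ->
  measurable_fun [set: R] f -> (forall x, 0 <= f x)%E ->
  (\int[mu]_x f x = a%:E * \int[mu]_x f (a * x + b)%R)%E.
Proof.
move=> a0 mf f0.
have mphi : measurable_fun setT ((fun x => a * x + b) : measurableTypeR R -> measurableTypeR R).
  by apply: measurable_funD => //; apply: measurable_funM.
pose phi : {mfun measurableTypeR R >-> measurableTypeR R} :=
  HB.pack (fun x : measurableTypeR R => (a * x + b : measurableTypeR R))
    (isMeasurableFun.Build _ _ _ _ _ mphi).
pose k : {nonneg R} := NngNum (ltW a0).
have muE A : measurable A -> mu A = mscale k (pushforward mu phi) A.
  apply: lebesgue_measure_unique => _ [[x y] /= _ <-].
  rewrite /mscale/= /pushforward/=.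
  have -> : (fun x0 : R => a * x0 + b) @^-1` `]x, y]%classic =
      `](x - b) / a, (y - b) / a]%classic.
    apply/seteqP; split => z /=; rewrite !in_itv/=.
      by rewrite ltr_pdivrMr// ler_pdivlMr// => /andP[xz zy]; apply/andP; split; lra.
    by rewrite ltr_pdivrMr// ler_pdivlMr// => /andP[xz zy]; apply/andP; split; lra.
  rewrite !lebesgue_measure_itv/= !lte_fin ltr_pM2r ?invr_gt0// ltrD2r.
  case: ifPn => _; last by rewrite mule0.
  by rewrite -!EFinD -EFinM; congr EFin; field; rewrite gt_eqF.
rewrite (@eq_measure_integral _ _ _ _ (mscale k (pushforward mu phi))); last first.
  by move=> A mA _; exact: muE.
rewrite ge0_integral_mscale//=.
by congr (_ * _)%E; rewrite ge0_integral_pushforward//= => [|? _]; rewrite ?preimage_setT.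
Qed.

Lemma ge0_integral_opp (f : R -> \bar R) :
  measurable_fun [set: R] f -> (forall x, 0 <= f x)%E ->
  (\int[mu]_x f x = \int[mu]_x f (- x)%R)%E.
Proof.
move=> mf f0.
rewrite -[in RHS](preimage_setT (-%R : measurableTypeR R -> measurableTypeR R)).
rewrite -(@ge0_integral_pushforward _ _ _ _ _
  (-%R : measurableTypeR R -> measurableTypeR R) _ _ setT)//.
by apply: eq_measure_integral => A mA _; exact/esym/lebesgue_measureN.
Qed.

Lemma ge0_integral_reflect (c : R) (f : R -> \bar R) :
  measurable_fun [set: R] f -> (forall x, 0 <= f x)%E ->
  (\int[mu]_x f x = \int[mu]_x f (c - x)%R)%E.
Proof.
move=> mf f0; rewrite (@ge0_integral_affine 1 c)// mul1e.
rewrite ge0_integral_opp//; last first.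
  apply: (measurableT_comp mf); apply: measurable_funD => //.
by apply: eq_integral => x _; rewrite mul1r addrC.
Qed.

End change_of_variables.

Section density.
Context d (T : measurableType d) (R : realType).
Variables (mu nu : {measure set T -> \bar R}) (w : T -> R).
Hypotheses (mw : measurable_fun setT w) (w0 : forall x, 0 <= w x).
Hypothesis nuE : forall A, measurable A -> nu A = (\int[mu]_(x in A) (w x)%:E)%E.

Import HBNNSimple.

Let density_nnsfun (f : {nnsfun T >-> R}) :
  (\int[nu]_x (f x)%:E = \int[mu]_x ((f x)%:E * (w x)%:E))%E.
Proof.
under [LHS]eq_integral do rewrite fimfunE -fsumEFin//.
rewrite ge0_integral_fsum//; last 2 first.
  - by move=> r; exact/measurable_EFinP/measurableT_comp.
  - by move=> n x _; rewrite EFinM nnfun_muleindic_ge0.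
under [RHS]eq_integral.
  move=> x xD; rewrite fimfunE -fsumEFin// muleC ge0_mule_fsumr; last first.
    by move=> r; rewrite EFinM nnfun_muleindic_ge0.
  over.
rewrite ge0_integral_fsum//; last 2 first.
  - move=> r; apply/measurable_EFinP; apply: measurable_funM => //.
    exact: measurableT_comp.
  - by move=> n x _; rewrite mule_ge0 ?lee_fin// -lee_fin EFinM nnfun_muleindic_ge0.
apply: eq_fsbigr => r _; rewrite integralZl_indic_nnsfun//.
have [r0|r0] := leP 0 r; last first.
  rewrite preimage_nnfun0// !integral_indic// set0I measure0 mule0.
  by rewrite integral0_eq// => x _; rewrite indic0 mulr0 mule0.
rewrite integral_indic// setIT nuE//.
rewrite -ge0_integralZl//=; last 2 first.
  - exact/measurable_EFinP/measurable_funTS.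
  - by move=> x _; rewrite lee_fin.
rewrite [LHS]integral_mkcond; apply: eq_integral => x _.
rewrite patchE -!EFinM indicE; case: ifPn => xr /=.
  by rewrite mulr1 mulrC.
by rewrite !mulr0.
Qed.

(** [normal_prob] is given on sets through its density; simple functions and monotone convergence
    carry this over to integrals. *)
Lemma ge0_integral_density (f : T -> \bar R) :
  measurable_fun setT f -> (forall x, 0 <= f x)%E ->
  (\int[nu]_x f x = \int[mu]_x (f x * (w x)%:E))%E.
Proof.
move=> mf f0.
pose f_ := nnsfun_approx measurableT mf.
transitivity (limn (fun n => \int[nu]_x (f_ n x)%:E)%E).
  rewrite -monotone_convergence//=.
  - apply: eq_integral => ? /[!inE] xD; apply/esym/cvg_lim => //=.
    exact: cvg_nnsfun_approx.
  - by move=> n; exact/measurable_EFinP/measurable_funTS.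
  - by move=> n ? _; rewrite lee_fin.
  - by move=> ? _ ? ? mn; rewrite lee_fin; exact/lefP/nd_nnsfun_approx.
under eq_fun do rewrite density_nnsfun.
rewrite -monotone_convergence//=.
- apply: eq_integral => x _; apply/cvg_lim => //.
  apply: cvgeZr => //; exact: cvg_nnsfun_approx.
- move=> n; apply/measurable_EFinP/measurable_funM => //.
- by move=> n x _; rewrite -EFinM lee_fin mulr_ge0.
- move=> x _ a b ab; rewrite lee_wpmul2r ?lee_fin//.
  exact/lefP/nd_nnsfun_approx.
Qed.

End density.

Lemma integral_probability_cst d (T : measurableType d) (R : realType)
  (Q : probability T R) (c : \bar R) : (\int[Q]_x c = c)%E.
Proof.
rewrite [LHS](@integral_cst _ T R Q setT measurableT c) -[RHS]mule1.
by congr (_ * _)%E; exact: probability_setT.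
Qed.

Section normal.
Context {R : realType}.
Notation mu := (@lebesgue_measure R).
Implicit Types (m s a c : R) (f : R -> \bar R).

Lemma measurable_expRM a : measurable_fun [set: R] (fun x => expR (a * x)).
Proof.
apply: (@measurableT_comp _ _ _ _ _ _ (@expR R)); first exact: measurable_expR.
by apply: measurable_funM.
Qed.

Lemma ge0_integral_normal m s f :
  measurable_fun [set: R] f -> (forall x, 0 <= f x)%E ->
  (\int[normal_prob m s]_x f x = \int[mu]_x (f x * (normal_pdf m s x)%:E))%E.
Proof.
move=> mf f0; rewrite (@ge0_integral_density _ _ _ mu (normal_prob m s)
  (normal_pdf m s))//; first exact: measurable_normal_pdf.
exact: normal_pdf_ge0.
Qed.

Lemma normal_pdf_expR m s : s != 0 ->
  normal_pdf m s = fun x => normal_peak s * expR (- (x - m) ^+ 2 / (s ^+ 2 *+ 2)).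
Proof. exact: normal_pdfE. Qed.

(** Completing the square: an exponential weight moves the mean by [a * s ^+ 2] and keeps the
    variance. With mean and variance both [t], the weight [a = -2] reverses the drift at constant
    factor 1. *)
Lemma normal_pdf_tilt m s a x : s != 0 ->
  expR (a * x) * normal_pdf m s x =
  expR (a * m + a ^+ 2 * s ^+ 2 / 2) * normal_pdf (m + a * s ^+ 2) s x.
Proof.
move=> s0; rewrite !normal_pdf_expR // mulrCA [RHS]mulrCA -!expRD.
by congr (_ * expR _); field.
Qed.

Lemma ge0_integral_normal_tilt m s a f : s != 0 ->
  measurable_fun [set: R] f -> (forall x, 0 <= f x)%E ->
  (\int[normal_prob m s]_x ((expR (a * x))%:E * f x) =
   (expR (a * m + a ^+ 2 * s ^+ 2 / 2))%:E *
   \int[normal_prob (m + a * s ^+ 2)%R s]_x f x)%E.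
Proof.
move=> s0 mf f0.
have mexp : measurable_fun [set: R] (fun x => (expR (a * x))%:E).
  by apply/measurable_EFinP; exact: measurable_expRM.
have mpdf m' : measurable_fun [set: R] (fun x => (normal_pdf m' s x)%:E).
  by apply/measurable_EFinP; exact: measurable_normal_pdf.
have h0 x : (0 <= (expR (a * x))%:E * f x)%E by rewrite mule_ge0// lee_fin expR_ge0.
rewrite (ge0_integral_normal _ _ (emeasurable_funM mexp mf) h0).
rewrite (ge0_integral_normal _ _ mf f0).
rewrite -ge0_integralZl//; last 2 first.
  exact: (emeasurable_funM mf (mpdf _)).
  by move=> x _; rewrite mule_ge0// lee_fin normal_pdf_ge0.
apply: eq_integral => x _.
by rewrite -muleA muleCA -EFinM normal_pdf_tilt// EFinM muleCA.
Qed.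

Lemma integral_normal_expR m s a : s != 0 ->
  (\int[normal_prob m s]_x (expR (a * x))%:E =
   (expR (a * m + a ^+ 2 * s ^+ 2 / 2))%:E)%E.
Proof.
move=> s0.
transitivity (\int[normal_prob m s]_x ((expR (a * x))%:E * cst 1 x))%E.
  by apply: eq_integral => x _; rewrite mule1.
rewrite (ge0_integral_normal_tilt m a s0 (measurable_cst _) (fun=> lee01)).
by rewrite [X in (_ * X)%E](integral_probability_cst
  (normal_prob (m + a * s ^+ 2) s) 1%E) mule1.
Qed.

(* Exponential Chebyshev with parameter [e / s ^+ 2]. *)
Lemma integral_normal_expR_tail m s a e : s != 0 -> 0 < e ->
  (\int[normal_prob m s]_x ((expR (a * x))%:E * (\1_`]e, +oo[ x)%:E) <=
   (expR (a * m + a ^+ 2 * s ^+ 2 / 2 + (m + a * s ^+ 2) * e / s ^+ 2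
     - e ^+ 2 / (s ^+ 2 *+ 2)))%:E)%E.
Proof.
move=> s0 e0; pose l := e / s ^+ 2.
have l0 : 0 < l by rewrite divr_gt0// exprn_even_gt0.
have -> : expR (a * m + a ^+ 2 * s ^+ 2 / 2 + (m + a * s ^+ 2) * e / s ^+ 2
     - e ^+ 2 / (s ^+ 2 *+ 2)) =
  expR (- (l * e)) * expR ((a + l) * m + (a + l) ^+ 2 * s ^+ 2 / 2).
  by rewrite -expRD; congr expR; rewrite /l; field.
rewrite [leRHS]EFinM -(integral_normal_expR m (a + l) s0) -ge0_integralZl//; last first.
- by apply/measurable_EFinP; exact: measurable_expRM.
apply: ge0_le_integral => //.
- apply/measurable_EFinP; apply: measurable_funM; last exact: measurable_indic.
  exact: measurable_expRM.
- apply/measurable_EFinP; apply: measurable_funM => //.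
  exact: measurable_expRM.
- move=> x _; rewrite -!EFinM lee_fin -expRD indicE.
  case: (boolP (x \in _)) => [|_]; last by rewrite mulr0 expR_ge0.
  rewrite inE/= in_itv/= andbT mulr1 ler_expR => ex.
  have : 0 <= l * (x - e) by rewrite mulr_ge0 ?ltW// subr_gt0.
  by lra.
Qed.

Lemma normal_prob_mkcond m s A :
  measurable A -> normal_prob m s A = (\int[mu]_x ((\1_A x * normal_pdf m s x)%:E))%E.
Proof.
move=> mA; rewrite /normal_prob integral_mkcond; apply: eq_integral => x _.
by rewrite patchE indicE; case: ifPn => _; rewrite ?mul1r ?mul0r.
Qed.

Let measurable_indic_pdf m s A : measurable A ->
  measurable_fun [set: R] (fun x => (\1_A x * normal_pdf m s x)%:E).
Proof.
move=> mA; apply/measurable_EFinP; apply: measurable_funM.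
  exact: measurable_indic.
exact: measurable_normal_pdf.
Qed.

Let indic_pdf_ge0 m s (A : set R) x : (0 <= (\1_A x * normal_pdf m s x)%:E)%E.
Proof. by rewrite lee_fin mulr_ge0// normal_pdf_ge0. Qed.

Lemma normal_prob_reflect m s c A : measurable A -> s != 0 ->
  normal_prob m s ((fun x => c - x) @^-1` A) = normal_prob (c - m) s A.
Proof.
move=> mA s0.
have mB : measurable ((fun x : R => c - x) @^-1` A).
  by rewrite -[_ @^-1` _]setTI; apply: measurable_funB.
rewrite (normal_prob_mkcond _ _ mB) (normal_prob_mkcond _ _ mA).
rewrite (ge0_integral_reflect c (measurable_indic_pdf _ _ mB) (indic_pdf_ge0 _ _ _)).
apply: eq_integral => x _; congr EFin; congr (_ * _).
  by rewrite !indicE; congr (nat_of_bool _)%:R; apply/idP/idP; rewrite !inE/= subKr.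
by rewrite !normal_pdf_expR//; congr (_ * expR _); field.
Qed.

Lemma normal_prob_shift m s c A : measurable A -> s != 0 ->
  normal_prob m s ((fun x => x + c) @^-1` A) = normal_prob (m + c) s A.
Proof.
move=> mA s0.
have mB : measurable ((fun x : R => x + c) @^-1` A).
  by rewrite -[_ @^-1` _]setTI; apply: measurable_funD.
rewrite (normal_prob_mkcond _ _ mB) (normal_prob_mkcond _ _ mA).
rewrite [RHS](ge0_integral_affine c ltr01 (measurable_indic_pdf _ _ mA)
  (indic_pdf_ge0 _ _ _)).
rewrite mul1e; apply: eq_integral => x _; rewrite mul1r; congr EFin; congr (_ * _).
by rewrite !normal_pdf_expR//; congr (_ * expR _); field.
Qed.

Lemma normal_prob_gt m s c : 0 < s ->
  normal_prob m s `]c, +oo[ = normal_prob 0 1 `](c - m) / s, +oo[.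
Proof.
move=> s0; have mI x : measurable (`]x, +oo[%classic : set R) by exact: measurable_itv.
rewrite (normal_prob_mkcond _ _ (mI c)) (normal_prob_mkcond _ _ (mI ((c - m) / s))).
rewrite (ge0_integral_affine m s0 (measurable_indic_pdf _ _ (mI c))
  (indic_pdf_ge0 _ _ _)).
rewrite -ge0_integralZl//; last 2 first.
- apply: (@measurableT_comp _ _ _ _ _ _ (fun x => (\1_`]c, +oo[%classic x * normal_pdf m s x)%:E)).
    exact: measurable_indic_pdf.
  by apply: measurable_funD => //; apply: measurable_funM.
- by rewrite lee_fin ltW.
apply: eq_integral => x _; rewrite -EFinM mulrCA; congr EFin; congr (_ * _).
  rewrite !indicE; congr (nat_of_bool _)%:R; apply/idP/idP; rewrite !inE/= !in_itv/= !andbT.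
    by rewrite ltr_pdivrMr//; lra.
  by rewrite ltr_pdivrMr//; lra.
rewrite !normal_pdf_expR ?gt_eqF ?oner_eq0// mulrA; congr (_ * expR _); last first.
  by field; rewrite gt_eqF.
rewrite /normal_peak expr1n mul1r -mulrnAr sqrtrM ?sqr_ge0// sqrtr_sqr gtr0_norm//.
by rewrite invfM mulrA divff ?mul1r// gt_eqF.
Qed.

End normal.

(* The function g of the header plus 1, so that only nonnegative functions are
   integrated. *)
Definition odd_step {R : realType} (z : R) : R :=
  1 + (0 < z)%R%:R - (z < 0)%R%:R * expR (2 * z).

Section odd_step.
Context {R : realType}.
Notation mu := (@lebesgue_measure R).
Implicit Types (s t x y z : R).

Lemma odd_step_ge0 z : 0 <= odd_step z.
Proof.
rewrite /odd_step; case: (ltrgt0P z) => z0.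
- by rewrite mul0r subr0 addr_ge0.
- by rewrite mul1r addr0 subr_ge0 -expR0 ler_expR mulr_ge0_le0// ltW.
- by rewrite mul0r subr0 addr_ge0.
Qed.

Lemma odd_step_gt0 z : 0 < z -> odd_step z = 2.
Proof. by move=> z0; rewrite /odd_step z0 ltNge ltW//= mul0r subr0; lra. Qed.

Lemma odd_step0 : odd_step (0 : R) = 1.
Proof. by rewrite /odd_step ltxx mul0r subr0 addr0. Qed.

Lemma odd_step_le1 z : z <= 0 -> odd_step z <= 1.
Proof.
move=> z0; rewrite /odd_step ltNge z0/= addr0 gerBl mulr_ge0// expR_ge0.
Qed.

Lemma measurable_odd_step : measurable_fun [set: R] (@odd_step R).
Proof.
apply: measurable_funB.
  apply: measurable_funD => //.
  have -> : (fun z : R => (0 < z)%R%:R : R) = \1_`]0, +oo[%classic.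
    by apply/funext => z; rewrite indicE mem_setE/= in_itv/= andbT.
  exact: measurable_indic.
apply: measurable_funM; last exact: measurable_expRM.
have -> : (fun z : R => (z < 0)%R%:R : R) = \1_`]-oo, 0[%classic.
  by apply/funext => z; rewrite indicE mem_setE/= in_itv/=.
exact: measurable_indic.
Qed.
End odd_step.

Section odd_step_normal.
Context {R : realType}.
Notation mu := (@lebesgue_measure R).
Implicit Types (s t x y z : R).

(** The negative term of g stands on the left, so that both sides are sums of nonnegative functions
    and their integrals split. *)
Lemma odd_stepE z :
  odd_step z + \1_`]-oo, 0[%classic z * expR (2 * z) = 1 + \1_`]0, +oo[%classic z.
Proof.
rewrite /odd_step !indicE !mem_setE/= !in_itv/= andbT.
by ring.
Qed.

Lemma measurable_itv_indicB (i : interval R) x :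
  measurable_fun [set: R] (fun y => \1_[set` i] (x - y) : R).
Proof.
apply: (@measurableT_comp _ _ _ _ _ _ (\1_[set` i] : R -> R)).
  exact: measurable_indic.
exact: measurable_funB.
Qed.

Lemma measurable_odd_stepB x : measurable_fun [set: R] (fun y => odd_step (x - y)).
Proof.
apply: (@measurableT_comp _ _ _ _ _ _ (@odd_step R)).
  exact: measurable_odd_step.
exact: measurable_funB.
Qed.

Lemma measurable_expRB x : measurable_fun [set: R] (fun y => expR (2 * (x - y))).
Proof.
apply: (@measurableT_comp _ _ _ _ _ _ (fun z => expR (2 * z))).
  exact: measurable_expRM.
exact: measurable_funB.
Qed.

(** [A] and [B] are the means of the negative and the positive part of g, so V(s, x) has the sign of
    [B s x - A s x]. *)
Let A s x := (\int[normal_prob s (Num.sqrt s)]_y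
  (\1_`]-oo, 0[%classic (x - y) * expR (2 * (x - y)))%:E)%E.
Let B s x := (\int[normal_prob s (Num.sqrt s)]_y (\1_`]0, +oo[%classic (x - y))%:E)%E.

(** The reflection of [y] to [2 * x - y] exchanges the two sides of [x]. The weight exp(2z) of g
    cancels what the drift contributes to the ratio of the densities; the factor that remains is, on
    [y < x], at most 1 for [0 <= x] and at least 1 for [x <= 0]. Compared with [BE], this gives the
    sign of V. *)
Let AE s x : 0 < s -> A s x = (\int[mu]_y (\1_`]0, +oo[%classic (x - y) *
   (expR (- (2 * (x - y) * x / s)) * normal_pdf s (Num.sqrt s) y))%:E)%E.
Proof.
move=> s0; have s1 : Num.sqrt s != 0 by rewrite sqrtr_eq0 -ltNge.
have mf : measurable_fun [set: R]
    (fun y => \1_`]-oo, 0[%classic (x - y) * expR (2 * (x - y))).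
  by apply: measurable_funM; [exact: measurable_itv_indicB|exact: measurable_expRB].
rewrite /A ge0_integral_normal//; last first.
  by apply/measurable_EFinP.
rewrite (@ge0_integral_reflect _ (2 * x)); first last.
- by move=> y; rewrite -EFinM lee_fin mulr_ge0// normal_pdf_ge0.
- apply: emeasurable_funM; first by apply/measurable_EFinP.
  by apply/measurable_EFinP; exact: measurable_normal_pdf.
apply: eq_integral => y _; rewrite -EFinM; congr EFin.
rewrite -[LHS]mulrA !indicE !mem_setE/= !in_itv/= andbT.
have -> : (x - (2 * x - y) < 0) = (0 < x - y).
  by apply/idP/idP => h; lra.
congr (_ * _). rewrite !normal_pdf_expR// !sqr_sqrtr ?ltW//.
rewrite mulrCA [RHS]mulrCA -!expRD; congr (_ * expR _).
by field; rewrite gt_eqF.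
Qed.

Let BE s x : B s x = (\int[mu]_y (\1_`]0, +oo[%classic (x - y) *
   normal_pdf s (Num.sqrt s) y)%:E)%E.
Proof.
rewrite /B ge0_integral_normal//.
by apply/measurable_EFinP; exact: measurable_itv_indicB.
Qed.

Let A_le1 s x : (A s x <= 1)%E.
Proof.
apply: (@le_trans _ _ (\int[normal_prob s (Num.sqrt s)]_y (cst 1 y))%E).
  apply: ge0_le_integral => //.
    apply/measurable_EFinP.
    by apply: measurable_funM; [exact: measurable_itv_indicB|exact: measurable_expRB].
  move=> y _; rewrite lee_fin indicE mem_setE/= in_itv/=.
  have [h|_] := ltP; last by rewrite mul0r.
  by rewrite mul1r -expR0 ler_expR mulr_ge0_le0// ltW.
by rewrite integral_cst//= mul1e [normal_prob _ _ _](@integral_normal_pdf R).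
Qed.

Let A_fin s x : A s x \is a fin_num.
Proof.
rewrite ge0_fin_numE; first exact: le_lt_trans (A_le1 _ _) (ltry _).
by apply: integral_ge0 => y _; rewrite lee_fin mulr_ge0// expR_ge0.
Qed.

Let VAB s x :
  (\int[normal_prob s (Num.sqrt s)]_y (odd_step (x - y))%:E + A s x = 1 + B s x)%E.
Proof.
rewrite /A /B -ge0_integralD//; last 3 first.
- by move=> y _; rewrite lee_fin odd_step_ge0.
- by apply/measurable_EFinP; exact: measurable_odd_stepB.
- apply/measurable_EFinP.
  by apply: measurable_funM; [exact: measurable_itv_indicB|exact: measurable_expRB].
under eq_integral do rewrite -EFinD odd_stepE EFinD.
rewrite ge0_integralD//; last first.
  by apply/measurable_EFinP; exact: measurable_itv_indicB.
congr (_ + _)%E.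
by rewrite integral_cst//= mul1e [normal_prob _ _ _](@integral_normal_pdf R).
Qed.

Let mE s x : measurable_fun [set: R] (fun y => \1_`]0, +oo[%classic (x - y) *
   (expR (- (2 * (x - y) * x / s)) * normal_pdf s (Num.sqrt s) y)).
Proof.
apply: measurable_funM; first exact: measurable_itv_indicB.
apply: measurable_funM; last exact: measurable_normal_pdf.
apply: measurableT_comp => //; apply: measurableT_comp => //.
apply: measurable_funM => //; apply: measurable_funM => //.
by apply: measurable_funM => //; apply: measurable_funB.
Qed.

Let mF s x : measurable_fun [set: R] (fun y => \1_`]0, +oo[%classic (x - y) *
   normal_pdf s (Num.sqrt s) y).
Proof.
apply: measurable_funM; first exact: measurable_itv_indicB.
exact: measurable_normal_pdf.
Qed.

Lemma odd_step_normal_ge1 s x : 0 < s -> 0 <= x ->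
  (1 <= \int[normal_prob s (Num.sqrt s)]_y (odd_step (x - y))%:E)%E.
Proof.
move=> s0 x0; rewrite -(leeD2rE _ _ (A_fin s x)) VAB leeD2l//.
rewrite AE// BE; apply: ge0_le_integral => //.
- by move=> y _; rewrite lee_fin !mulr_ge0 ?expR_ge0 ?normal_pdf_ge0.
- by apply/measurable_EFinP; exact: mE.
- by apply/measurable_EFinP; exact: mF.
move=> y _; rewrite lee_fin indicE mem_setE/= in_itv/= andbT.
have [h|_] := ltP; last by rewrite !mul0r.
rewrite !mul1r ler_piMl ?normal_pdf_ge0// -expR0 ler_expR oppr_le0.
by rewrite !mulr_ge0 ?invr_ge0// ltW.
Qed.

Lemma odd_step_normal_le1 s x : 0 < s -> x <= 0 ->
  (\int[normal_prob s (Num.sqrt s)]_y (odd_step (x - y))%:E <= 1)%E.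
Proof.
move=> s0 x0; rewrite -(leeD2rE _ _ (A_fin s x)) VAB leeD2l//.
rewrite AE// BE; apply: ge0_le_integral => //.
- by move=> y _; rewrite lee_fin mulr_ge0 ?normal_pdf_ge0.
- by apply/measurable_EFinP; exact: mF.
- by apply/measurable_EFinP; exact: mE.
move=> y _; rewrite lee_fin indicE mem_setE/= in_itv/= andbT.
have [h|_] := ltP; last by rewrite !mul0r.
rewrite !mul1r ler_peMl ?normal_pdf_ge0// -expR0 ler_expR oppr_ge0.
by rewrite mulr_le0_ge0 ?invr_ge0 ?(ltW s0)// mulr_ge0_le0// mulr_ge0// ltW.
Qed.

End odd_step_normal.

Section exponential_weight.
Context {R : realType}.
Notation mu := (@lebesgue_measure R).
Notation psi := (@exponential_pdf R 2).
Implicit Types (s t x y z : R).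

Let psi0 x : 0 <= psi x.
Proof. exact: exponential_pdf_ge0. Qed.

Let mpsi : measurable_fun [set: R] (fun x => (psi x)%:E).
Proof. by apply/measurable_EFinP; exact: measurable_exponential_pdf. Qed.

Lemma integral_exponential_pdf2 : (\int[mu]_x (psi x)%:E = 1)%E.
Proof. exact: integral_exponential_pdf. Qed.

Let cexpNM : continuous (fun z : R^o => expR (- 2 * z)).
Proof.
move=> z; apply: continuous_comp; last exact: continuous_expR.
by apply: continuousM => //; apply: (@continuousN _ R^o); exact: cst_continuous.
Qed.

Lemma exponential_pdf_tail_cy y : 0 <= y ->
  (\int[mu]_x (\1_`[y, +oo[%classic x * psi x)%:E = (expR (- (2 * y)))%:E)%E.
Proof.
move=> y0.
transitivity (\int[mu]_(x in `[y, +oo[) (psi x)%:E)%E.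
  rewrite [RHS]integral_mkcond; apply: eq_integral => x _.
  by rewrite patchE indicE; case: ifPn => _; rewrite ?mul1r ?mul0r.
rewrite (@ge0_continuous_FTC2y _ _
  (fun x => - (expR (- 2 * x))) _ 0)//.
- by rewrite sub0e EFinN oppeK mulNr.
- apply: (@continuous_subspaceW R^o _ _ [set` `[0, +oo[%R]).
    by move=> x /=; rewrite !in_itv/= !andbT; exact: le_trans.
  exact: within_continuous_exponential_pdf.
- rewrite -oppr0; apply: cvgN.
  rewrite (_ : (fun x => expR (- 2 * x)) =
               (fun z => expR (- z)) \o (fun z => 2 * z)); last first.
    by apply: eq_fun => x; rewrite mulNr.
  apply: (@cvg_comp _ _ _ _ _ _ (pinfty_nbhs R)); last exact: cvgr_expR.
  exact: gt0_cvgMry.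
- by apply: cvgN; apply/cvg_at_right_filter; exact: cexpNM.
- move=> x; rewrite in_itv/= andbT => yx.
  by apply: derive1_exponential_pdf; rewrite in_itv/= andbT (le_lt_trans y0).
Qed.

Lemma exponential_pdf_tail y : 0 <= y ->
  (\int[mu]_x (\1_`]y, +oo[%classic x * psi x)%:E = (expR (- (2 * y)))%:E)%E.
Proof.
move=> y0; rewrite -exponential_pdf_tail_cy//.
transitivity (\int[mu]_(x in `]y, +oo[) (psi x)%:E)%E.
  rewrite [RHS]integral_mkcond; apply: eq_integral => x _.
  by rewrite patchE indicE; case: ifPn => _; rewrite ?mul1r ?mul0r.
rewrite integral_itv_obnd_cbnd; last exact: measurable_funTS.
rewrite [LHS]integral_mkcond; apply: eq_integral => x _.
by rewrite patchE indicE; case: ifPn => _; rewrite ?mul1r ?mul0r.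
Qed.

(** For [0 <= x] the density at [x] is exactly [expR (2 * e)] times the density at [x + e]; the
    inequality comes from the mass of [0, e). The shift that absorbs the overshoot thus costs a
    factor that tends to 1 with [e]. *)
Lemma exponential_pdf_shift_le (e : R) (f : R -> \bar R) : 0 <= e ->
  measurable_fun [set: R] f -> (forall x, 0 <= f x)%E ->
  (\int[mu]_x (f (x + e)%R * (psi x)%:E) <=
   (expR (2 * e))%:E * \int[mu]_x (f x * (psi x)%:E))%E.
Proof.
move=> e0 mf f0.
have mfp : measurable_fun [set: R] (fun x => f x * (psi x)%:E)%E.
  exact: (emeasurable_funM mf mpsi).
have fp0 x : (0 <= f x * (psi x)%:E)%E by rewrite mule_ge0// lee_fin.
rewrite [in leRHS](@ge0_integral_affine _ 1 e)// mul1e.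
have madd : measurable_fun [set: R] (fun x : R => 1 * x + e).
  by apply: measurable_funD => //; apply: measurable_funM.
rewrite -ge0_integralZl//; last first.
  exact: (measurableT_comp mfp madd).
apply: ge0_le_integral => //.
- by move=> x _; rewrite mule_ge0// lee_fin.
- apply: emeasurable_funM => //; apply: (measurableT_comp mf).
  exact: measurable_funD.
- by apply: emeasurable_funM => //; exact: (measurableT_comp mfp madd).
move=> x _; rewrite mul1r muleCA lee_wpmul2l// -EFinM lee_fin.
have [x0|x0] := ltP x 0.
  by rewrite lt0_exponential_pdf// mulr_ge0// expR_ge0.
rewrite !exponential_pdfE//; last by rewrite addr_ge0.
rewrite /= mulrCA -expRD.
by rewrite (_ : 2 * e + _ = - 2 * x)//; lra.
Qed.

(** For [0 <= y] the exponentials of g and of the density cancel on [0, y) to the constant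
    [2 * expR (- (2 * y))]; its integral over this interval is the source of the term linear in
    [y]. *)
Lemma integral_odd_step_exponential y :
  (\int[mu]_x (odd_step (x - y) * psi x)%:E =
   (1 + \1_`]-oo, 0[%classic y
      + \1_`[0, +oo[%classic y * (expR (- (2 * y)) * (1 - 2 * y)))%:E)%E.
Proof.
rewrite !indicE !mem_setE/= !in_itv/= andbT.
have [y0|y0] := ltP y 0.
  rewrite mul0r addr0 /=.
  rewrite (@eq_integral _ _ _ mu _ (fun x => 2%:E * (psi x)%:E)%E); last first.
    move=> x _; rewrite -EFinM; congr EFin.
    have [x0|x0] := ltP x 0; first by rewrite lt0_exponential_pdf// !mulr0.
    by rewrite odd_step_gt0// subr_gt0 (lt_le_trans y0).
  rewrite ge0_integralZl//; last by move=> x _; rewrite lee_fin.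
  by rewrite integral_exponential_pdf2 mule1; congr EFin; rewrite /= mulr1n; lra.
rewrite addr0 mul1r.
have mindic : measurable_fun [set: R] (fun x => (\1_`[0, y[%classic x * (2 * expR (- (2 * y))))%:E).
  apply/measurable_EFinP; apply: measurable_funM => //.
(* The subtracted integral is added to the left, which keeps every integrand nonnegative. *)
have h : (\int[mu]_x (odd_step (x - y) * psi x)%:E + (2 * y * expR (- (2 * y)))%:E =
    (1 + expR (- (2 * y)))%:E)%E.
  have -> : (2 * y * expR (- (2 * y)))%:E =
      (\int[mu]_x (\1_`[0, y[%classic x * (2 * expR (- (2 * y))))%:E)%E.
    under eq_integral do rewrite EFinM.
    rewrite ge0_integralZr//; last first.
      by apply/measurable_EFinP; exact: measurable_indic.
    rewrite integral_indic//= setIT lebesgue_measure_itv/= lte_fin.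
    case: ltgtP y0 => // [y0 _|<- _]; last by rewrite mulr0 !mul0r mul0e.
    by rewrite -EFinD -EFinM; congr EFin; rewrite subr0; ring.
  rewrite EFinD -(exponential_pdf_tail y0) -integral_exponential_pdf2.
  rewrite -!ge0_integralD//; last 5 first.
  - by move=> x _; rewrite lee_fin.
  - by move=> x _; rewrite lee_fin mulr_ge0.
  - apply/measurable_EFinP; apply: measurable_funM => //.
    exact: measurable_exponential_pdf.
  - by move=> x _; rewrite lee_fin mulr_ge0 ?odd_step_ge0.
  - apply/measurable_EFinP; apply: measurable_funM.
      apply: (@measurableT_comp _ _ _ _ _ _ (@odd_step R)).
        exact: measurable_odd_step.
      exact: measurable_funB.
    exact: measurable_exponential_pdf.
  apply: eq_integral => x _; rewrite -!EFinD; congr EFin.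
  rewrite !indicE !mem_setE/= !in_itv/= andbT.
  have [x0|x0] := ltP x 0.
    by rewrite lt0_exponential_pdf// mul0r !mulr0 addr0.
  rewrite -subr_lt0 /=.
  rewrite -[X in _ = X + _]mul1r -mulrDl.
  have := odd_stepE (x - y); rewrite !indicE !mem_setE/= !in_itv/= andbT subr_gt0 => <-.
  rewrite [RHS]mulrDl; congr (_ + _); rewrite -mulrA; congr (_ * _).
  rewrite exponential_pdfE//= mulrCA -expRD; congr (_ * expR _); lra.
rewrite -[LHS](@addeK _ (2 * y * expR (- (2 * y)))%:E _)// h -EFinB; congr EFin.
by rewrite /=; ring.
Qed.

End exponential_weight.

Section normal_first_moment.
Context {R : realType}.
Notation mu := (@lebesgue_measure R).
Implicit Types (t x y z : R).

Lemma is_derive_normal_pdf t y : 0 < t ->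
  is_derive y (1:R) (fun x : R => - t * normal_pdf (- t) (Num.sqrt t) x)
    ((y + t) * normal_pdf (- t) (Num.sqrt t) y).
Proof.
move=> t0; have s0 : Num.sqrt t != 0 by rewrite sqrtr_eq0 -ltNge.
rewrite normal_pdf_expR // sqr_sqrtr ?(ltW t0)//.
have D : is_derive y (1:R) (fun x : R => - (x - - t) ^+ 2 / (t *+ 2)) (- (y + t) / t).
  apply: is_derive_eq.
  by rewrite /GRing.scale/=; field; rewrite gt_eqF.
apply: is_derive_eq.
by rewrite /GRing.scale/=; field; rewrite gt_eqF.
Qed.

Lemma normal_pdf_cvg0 t : 0 < t ->
  normal_pdf (- t) (Num.sqrt t) x @[x --> +oo] --> 0.
Proof.
move=> t0; have s0 : Num.sqrt t != 0 by rewrite sqrtr_eq0 -ltNge.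
rewrite normal_pdf_expR // -[X in _ --> X](mulr0 (normal_peak (Num.sqrt t))).
apply: cvgM; first exact: cvg_cst.
apply: (@squeeze_cvgr _ _ _ _ (cst 0) (fun x => expR (- x))).
- near=> x; rewrite expR_ge0/= ler_expR sqr_sqrtr ?(ltW t0)// opprK.
  rewrite mulNr lerN2 ler_pdivlMr ?pmulrn_lgt0//.
  (* Since (x + t)^2 >= 2tx, the Gaussian exponent is at most -x. *)
  have := sqr_ge0 x; have := sqr_ge0 t; rewrite !expr2 -mulr_natr; nra.
- exact: cvg_cst.
- exact: cvgr_expR.
Unshelve. all: by end_near. Qed.

Let psi t := normal_tail (Num.sqrt t).

Lemma normal_tailE x : (normal_tail x)%:E = normal_prob 0 1 `]x, +oo[.
Proof.
rewrite /normal_tail fineK//.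
by rewrite (fin_num_measure (normal_prob (0 : R) 1)).
Qed.

Lemma normal_prob_oy t : 0 < t ->
  normal_prob (- t) (Num.sqrt t) `]0, +oo[ = (psi t)%:E.
Proof.
move=> t0; rewrite normal_tailE [LHS]normal_prob_gt ?sqrtr_gt0//.
by rewrite sub0r opprK -{1}(sqr_sqrtr (ltW t0)) expr2 mulfK// gt_eqF// sqrtr_gt0.
Qed.

Lemma normal_prob_cy t : 0 < t ->
  normal_prob (- t) (Num.sqrt t) `[0, +oo[ = (psi t)%:E.
Proof.
move=> t0; rewrite -normal_prob_oy// /normal_prob integral_itv_obnd_cbnd//.
by apply/measurable_EFinP; apply: measurable_funTS; exact: measurable_normal_pdf.
Qed.

Lemma normal_prob_Nyo t : 0 < t ->
  normal_prob t (Num.sqrt t) `]-oo, 0[ = (psi t)%:E.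
Proof.
move=> t0; transitivity (normal_prob (0 - - t) (Num.sqrt t) `]-oo, 0[).
  by rewrite sub0r opprK.
have s0 : Num.sqrt t != 0 by rewrite sqrtr_eq0 -ltNge.
rewrite -(normal_prob_reflect _ 0 (measurable_itv _) s0) -(normal_prob_oy t0).
congr normal_prob.
by apply/seteqP; split => x /=; rewrite !in_itv/= andbT; lra.
Qed.

(** For mean [- t] and variance [t], the function [y + t] times the density is the derivative of
    [- t] times the density. The integral over the half-line is therefore a boundary value at 0. *)
Lemma normal_first_moment t : 0 < t ->
  (\int[normal_prob (- t) (Num.sqrt t)]_y (\1_`[0, +oo[%classic y * y)%:E
   + (t * psi t)%:E = (t * normal_pdf (- t) (Num.sqrt t) 0)%:E)%E.
Proof.
move=> t0; have s0 : Num.sqrt t != 0 by rewrite sqrtr_eq0 -ltNge.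
have mi : measurable_fun [set: R] (fun y : R => \1_`[0, +oo[%classic y * y).
  by apply: measurable_funM => //; exact: measurable_indic.
have mp := @measurable_normal_pdf R (- t) (Num.sqrt t).
rewrite ge0_integral_normal//; last 2 first.
- by apply/measurable_EFinP.
- move=> y; rewrite lee_fin indicE mem_setE/= in_itv/= andbT.
  by have [y0|y0] := leP 0 y; rewrite ?mul1r ?mul0r.
rewrite EFinM -normal_prob_cy// normal_prob_mkcond// -ge0_integralZl//; last 3 first.
- by apply/measurable_EFinP; apply: measurable_funM => //; exact: measurable_indic.
- by move=> x _; rewrite lee_fin mulr_ge0// normal_pdf_ge0.
- by rewrite lee_fin ltW.
rewrite -ge0_integralD//; last 4 first.
- move=> y _; rewrite -EFinM lee_fin indicE mem_setE/= in_itv/= andbT.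
  by have [y0|y0] := leP 0 y; rewrite ?mul1r ?mul0r// mulr_ge0// normal_pdf_ge0.
- by apply/measurable_EFinP; apply: measurable_funM.
- by move=> y _; rewrite -EFinM lee_fin mulr_ge0 ?(ltW t0)// mulr_ge0// normal_pdf_ge0.
- apply/measurable_EFinP; apply: measurable_funM => //; exact: measurable_funM.
transitivity (\int[mu]_(y in `[0%R, +oo[) ((y + t) * normal_pdf (- t) (Num.sqrt t) y)%:E)%E.
  rewrite [RHS]integral_mkcond; apply: eq_integral => y _.
  rewrite patchE -!EFinM -EFinD indicE; case: ifPn => _ /=; last by rewrite !mul0r mulr0 addr0.
  by congr EFin; ring.
rewrite (@ge0_continuous_FTC2y _ _ (fun x : R => - t * normal_pdf (- t) (Num.sqrt t) x) _ 0).
- by rewrite sub0e -EFinN mulNr opprK.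
- by move=> x x0; rewrite mulr_ge0 ?normal_pdf_ge0// addr_ge0// ltW.
- apply: continuous_subspaceT => x.
  apply: cvgM; last exact: continuous_normal_pdf.
  by apply: cvgD; [exact: cvg_id|exact: cvg_cst].
- rewrite -[X in _ --> X](mulr0 (- t)); apply: cvgM; first exact: cvg_cst.
  exact: normal_pdf_cvg0.
- by move=> x _; have [] := is_derive_normal_pdf x t0.
- apply: cvg_at_right_filter; apply: cvgM; first exact: cvg_cst.
  exact: continuous_normal_pdf.
- by move=> x _; rewrite derive1E; have [_ ->] := is_derive_normal_pdf x t0.
Qed.

(** The boundary value of [normal_first_moment], doubled, is the second term of the final
    formula. *)
Lemma normal_pdf_at0 t : 0 < t ->
  2 * (t * normal_pdf (- t) (Num.sqrt t) 0) = Num.sqrt (2 * t / pi) * expR (- t / 2).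
Proof.
move=> t0; have s0 : Num.sqrt t != 0 by rewrite sqrtr_eq0 -ltNge.
rewrite normal_pdf_expR// /normal_peak sqr_sqrtr ?(ltW t0)// sub0r opprK !mulrA.
congr (_ * expR _); last by field; rewrite gt_eqF.
move: pi (@pi_gt0 R) => p p0.
have -> : 2 * t / p = (2 * t) ^+ 2 / (t * p *+ 2).
  by field; rewrite !gt_eqF.
rewrite sqrtrM ?sqr_ge0// sqrtr_sqr ger0_norm ?mulr_ge0 ?(ltW t0)//.
by rewrite sqrtrV// mulrn_wge0// mulr_ge0 ?ltW.
Qed.

(** The weight exp(-2y) turns the normal law of mean [t] into that of mean [- t]. By symmetry each
    of the two indicators then contributes one normal tail, and the linear term contributes the
    truncated first moment; the latter supplies the remaining [2 * t] tails and the density at 0. *)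
Lemma integral_odd_step_exponential_normal t : 0 < t ->
  (\int[normal_prob t (Num.sqrt t)]_y
     (\int[mu]_x (odd_step (x - y) * exponential_pdf 2 x)%:E) =
   (1 + (2 * (1 + t) * normal_tail (Num.sqrt t)
         - Num.sqrt (2 * t / pi) * expR (- t / 2)))%:E)%E.
Proof.
move=> t0; have s0 : Num.sqrt t != 0 by rewrite sqrtr_eq0 -ltNge.
under eq_integral do rewrite integral_odd_step_exponential.
set N := normal_prob t (Num.sqrt t).
pose G y : R := 1 + \1_`]-oo, 0[%classic y
      + \1_`[0, +oo[%classic y * (expR (- (2 * y)) * (1 - 2 * y)).
have me : measurable_fun [set: R] (fun y : R => expR (- (2 * y))).
  by under eq_fun do rewrite -mulNr; exact: measurable_expRM.
have mi1 : measurable_fun [set: R] (\1_`[0, +oo[%classic : R -> R).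
  exact: measurable_indic.
have mi2 : measurable_fun [set: R] (\1_`]-oo, 0[%classic : R -> R).
  exact: measurable_indic.
have mG : measurable_fun [set: R] G.
  apply: measurable_funD; first by apply: measurable_funD.
  apply: measurable_funM => //; apply: measurable_funM => //.
  by apply: measurable_funB => //; apply: measurable_funM.
have G0 y : (0 <= (G y)%:E)%E.
  rewrite -integral_odd_step_exponential; apply: integral_ge0 => x _.
  by rewrite lee_fin mulr_ge0 ?odd_step_ge0// exponential_pdf_ge0.
have tilt (f : R -> R) : measurable_fun [set: R] f -> (forall y, 0 <= f y) ->
   (\int[N]_y (expR (- (2 * y)) * f y)%:E =
    \int[normal_prob (- t) (Num.sqrt t)]_y (f y)%:E)%E.
  move=> mf f0; have mEf : measurable_fun [set: R] (EFin \o f).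
    exact/measurable_EFinP.
  have := ge0_integral_normal_tilt t (-2) s0 mEf (fun y => f0 y).
  have -> : -2 * t + (-2) ^+ 2 * Num.sqrt t ^+ 2 / 2 = 0.
    by rewrite sqr_sqrtr ?(ltW t0)//; field.
  have -> : t + -2 * Num.sqrt t ^+ 2 = - t.
    by rewrite sqr_sqrtr ?(ltW t0)//; ring.
  rewrite expR0 mul1e.
  move=> <-.
  by apply: eq_integral => y _; rewrite -EFinM mulNr.
have mf2 : measurable_fun [set: R] (fun y : R => \1_`[0, +oo[%classic y * y).
  by apply: measurable_funM.
have f20 y : 0 <= \1_`[0, +oo[%classic y * y :> R.
  rewrite indicE mem_setE/= in_itv/= andbT.
  by have [y0|y0] := leP 0 y; rewrite ?mul1r ?mul0r.
set J := (\int[normal_prob (- t) (Num.sqrt t)]_y (\1_`[0, +oo[%classic y * y)%:E)%E.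
have JE := normal_first_moment t0; rewrite -/J in JE.
have {}JE : J = (t * normal_pdf (- t) (Num.sqrt t) 0 - t * psi t)%:E.
  by rewrite EFinB -JE addeK.
(* [2%:E * J] is the negative part of [G] after the tilt, moved to the left for the sake of
   nonnegativity. *)
have H : (\int[N]_y (G y)%:E + 2%:E * J = (1 + 2 * psi t)%:E)%E.
  rewrite /J -ge0_integralZl//; last 2 first.
  - by apply/measurable_EFinP.
  - by move=> y _; rewrite lee_fin.
  under [X in (_ + X)%E]eq_integral do rewrite -EFinM.
  have mf3 : measurable_fun [set: R] (fun y => 2 * (\1_`[0, +oo[%classic y * y)).
    exact: measurable_funM.
  rewrite -(tilt _ mf3 (fun y => mulr_ge0 (ler0n _ 2) (f20 y))).
  rewrite -ge0_integralD//; last 3 first.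
  - by apply/measurable_EFinP.
  - by move=> y _; rewrite lee_fin mulr_ge0 ?expR_ge0// mulr_ge0.
  - apply/measurable_EFinP; apply: measurable_funM => //; exact: measurable_funM.
  transitivity (\int[N]_y ((cst 1 y) + ((\1_`]-oo, 0[%classic y)%:E +
       (expR (- (2 * y)) * \1_`[0, +oo[%classic y)%:E)))%E.
    apply: eq_integral => y _; rewrite -!EFinD; congr EFin; rewrite /G; ring.
  rewrite ge0_integralD//; last 2 first.
  - by move=> y _; rewrite -EFinD lee_fin addr_ge0// mulr_ge0 ?expR_ge0.
  - by apply: emeasurable_funD; apply/measurable_EFinP => //; exact: measurable_funM.
  rewrite ge0_integralD//;
    try by [apply/measurable_EFinP|apply/measurable_EFinP; exact: measurable_funM].
  rewrite (tilt _ mi1 (fun=> ler0n _ _)) !integral_indic// !setIT.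
  rewrite [X in (_ + (X + _))%E](normal_prob_Nyo t0).
  rewrite [X in (_ + (_ + X))%E](normal_prob_cy t0).
  rewrite integral_cst//= mul1e /N [normal_prob _ _ _](@integral_normal_pdf R).
  by rewrite -!EFinD; congr EFin; ring.
have Jfin : (2%:E * J)%E \is a fin_num by rewrite JE.
transitivity (\int[N]_y (G y)%:E)%E => //.
rewrite -(@addeK _ (2%:E * J)%E (\int[N]_y (G y)%:E)%E)// H JE.
rewrite -EFinM -EFinB; congr EFin.
rewrite -normal_pdf_at0// /psi; ring.
Qed.

End normal_first_moment.

(** * Independence *)

Section independence.
Context d (T : measurableType d) (R : realType) (P : probability T R).
Implicit Types (X Y Z : {mfun T >-> R}) (s : seq {mfun T >-> R})
  (l : seq ({mfun T >-> R} * set R)).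

Definition cylinder l : set T := \big[setI/setT]_(p <- l) (p.1 @^-1` p.2).

(* Mutual independence, with the events listed along with the variables so that
   adjacent variables can be merged into a function of both. *)
Definition indep_seq s := forall l, map fst l = s ->
  all (fun p => `[<measurable p.2>]) l ->
  P (cylinder l) = (\prod_(p <- l) P (p.1 @^-1` p.2))%E.

Let measurable_preimage X (A : set R) : measurable A -> measurable (X @^-1` A).
Proof. by move=> mA; rewrite -[_ @^-1` _]setTI; exact: measurable_funPT. Qed.

Lemma measurable_cylinder l :
  all (fun p => `[<measurable p.2>]) l -> measurable (cylinder l).
Proof.
rewrite /cylinder; elim: l => [|[X A] l IH] /=; first by rewrite big_nil.
move=> /andP[/asboolP mA /IH ml]; rewrite big_cons; apply: measurableI => //.
exact: measurable_preimage.
Qed.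

Lemma cylinder_cat l1 l2 : cylinder (l1 ++ l2) = cylinder l1 `&` cylinder l2.
Proof. by rewrite /cylinder big_cat. Qed.

Lemma cylinder_cons X A l : cylinder ((X, A) :: l) = X @^-1` A `&` cylinder l.
Proof. by rewrite /cylinder big_cons. Qed.

Let pad s : seq ({mfun T >-> R} * set R) := [seq (X, setT) | X <- s].

Let cylinder_pad s : cylinder (pad s) = setT.
Proof.
elim: s => [|X s IH] /=; first by rewrite /cylinder big_nil.
by rewrite cylinder_cons IH preimage_setT setIT.
Qed.

Let prod_pad s : (\prod_(p <- pad s) P (p.1 @^-1` p.2) = 1)%E.
Proof.
elim: s => [|X s IH] /=; first by rewrite big_nil.
by rewrite big_cons/= IH preimage_setT probability_setT mule1.
Qed.

Let all_pad s : all (fun p => `[<measurable p.2>]) (pad s).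
Proof. by elim: s => //= X s ->; rewrite andbT; apply/asboolP. Qed.

Let fst_pad s : map fst (pad s) = s.
Proof. by rewrite -map_comp map_id. Qed.

Lemma indep_seq_mid s1 s s2 : indep_seq (s1 ++ s ++ s2) -> indep_seq s.
Proof.
move=> H l ls ml.
have := H (pad s1 ++ l ++ pad s2); rewrite !map_cat !fst_pad ls => /(_ erefl).
rewrite !all_cat !all_pad ml => /(_ isT).
by rewrite !big_cat/= !prod_pad mul1e mule1 !cylinder_cat !cylinder_pad setTI setIT.
Qed.

(** This provides the starting value of a fold as one more independent variable. *)
Lemma indep_seq_insert_cst s1 s2 (c : R) :
  indep_seq (s1 ++ s2) -> indep_seq (s1 ++ (cst c : {mfun T >-> R}) :: s2).
Proof.
move=> H l ls ml.
have [l1 [A [l2 [lE l1E l2E]]]] : exists l1 A l2,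
    [/\ l = l1 ++ ((cst c : {mfun T >-> R}), A) :: l2, map fst l1 = s1 & map fst l2 = s2].
  have := cat_take_drop (size s1) l.
  have h1 : map fst (take (size s1) l) = s1 by rewrite map_take ls take_size_cat.
  have : map fst (drop (size s1) l) = (cst c : {mfun T >-> R}) :: s2.
    by rewrite map_drop ls drop_size_cat.
  case: (drop _ _) => //= -[X A] l2 [] /= XE l2E lE.
  by exists (take (size s1) l), A, l2; split => //; rewrite -XE lE.
move: ml; rewrite lE all_cat/= => /and3P[m1 /asboolP mA m2].
have := H (l1 ++ l2); rewrite map_cat l1E l2E => /(_ erefl).
rewrite all_cat m1 m2 => /(_ isT).
rewrite !cylinder_cat cylinder_cons !big_cat/= big_cons/=.
have [Ac|nAc] := pselect (A c).
  have -> : cst c @^-1` A = [set: T] by apply/seteqP; split.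
  by rewrite setTI probability_setT mul1e.
have -> : cst c @^-1` A = set0 :> set T by apply/seteqP; split.
by rewrite set0I setI0 measure0 mul0e mule0.
Qed.

Definition joint X Y (w : T) := (X w, Y w).

Lemma measurable_joint X Y : measurable_fun setT (joint X Y).
Proof. exact: measurable_fun_pair. Qed.

(** The law of the pair under [P] conditioned on [C] agrees with the product law on rectangles,
    hence everywhere. A null [C] cannot be normalised and is treated apart. In use, [C] is an event
    of the other variables of a family. *)
Lemma indep_joint_given (C : set T) X Y : measurable C ->
  (forall A B, measurable A -> measurable B ->
    P (C `&` (X @^-1` A `&` Y @^-1` B)) =
      (P C * (P (X @^-1` A) * P (Y @^-1` B)))%E) ->
  forall D : set (R * R), measurable D ->
    P (C `&` joint X Y @^-1` D) =
      (P C * (distribution P X \x distribution P Y)%E D)%E.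
Proof.
move=> mC H D mD.
have mXY := measurable_joint X Y.
have mDJ : measurable (joint X Y @^-1` D) by rewrite -[_ @^-1` _]setTI; exact: mXY.
have [C0|C0] := eqVneq (P C) 0%E.
  rewrite C0 mul0e; apply/eqP; rewrite eq_le measure_ge0 andbT -C0.
  by apply: le_measure; rewrite ?inE//; exact: measurableI.
have [c cE] : exists c, P C = c%:E.
  by exists (fine (P C)); rewrite fineK// fin_num_measure.
have c0 : 0 < c by rewrite -lte_fin -cE lt0e C0 measure_ge0.
have c'0 : 0 <= c^-1 by rewrite invr_ge0 ltW.
pose k : {nonneg R} := NngNum c'0.
pose J : {mfun T >-> (R * R)%type} :=
  HB.pack (joint X Y) (isMeasurableFun.Build _ _ _ _ _ mXY).
pose m' : {measure set (R * R) -> \bar R} := mscale k (pushforward (mrestr P mC) J).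
rewrite (@product_measure_unique _ _ _ _ _ _ _ (m' mXY))//.
  rewrite /m' /mscale/= /pushforward/= /mrestr/= setIC.
  by rewrite cE muleA -EFinM divff ?gt_eqF// mul1e.
move=> A B mA mB; rewrite /m' /mscale/= /pushforward/= /mrestr/= /distribution.
transitivity (c^-1%:E * P (C `&` (X @^-1` A `&` Y @^-1` B)))%E.
  congr (_ * P _)%E; rewrite setIC; apply/seteqP.
  by split=> w [Cw [? ?]]; split.
by rewrite H// cE muleA -EFinM mulVf ?gt_eqF// mul1e.
Qed.

Lemma indep_seq2 X Y A B : indep_seq [:: X; Y] -> measurable A -> measurable B ->
  P (X @^-1` A `&` Y @^-1` B) = (P (X @^-1` A) * P (Y @^-1` B))%E.
Proof.
move=> H mA mB; have := H [:: (X, A); (Y, B)] erefl.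
rewrite /= !cylinder_cons /cylinder !big_cons !big_nil/= setIT mule1; apply.
by rewrite andbT; apply/andP; split; apply/asboolP.
Qed.

Lemma indep_joint X Y D : indep_seq [:: X; Y] -> measurable D ->
  P (joint X Y @^-1` D) = (distribution P X \x distribution P Y)%E D.
Proof.
move=> H mD; have := @indep_joint_given setT X Y measurableT.
rewrite probability_setT => /(_ _ D mD); rewrite setTI mul1e; apply => A B mA mB.
by rewrite setTI mul1e indep_seq2.
Qed.

Lemma indep_integral X Y (f : R * R -> \bar R) : indep_seq [:: X; Y] ->
  measurable_fun setT f -> (forall z, 0 <= f z)%E ->
  (\int[P]_w f (X w, Y w) =
   \int[distribution P X]_x \int[P]_w f (x, Y w))%E.
Proof.
move=> H mf f0.
have mXY := measurable_joint X Y.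
pose J : {mfun T >-> (R * R)%type} :=
  HB.pack (joint X Y) (isMeasurableFun.Build _ _ _ _ _ mXY).
transitivity (\int[distribution P X \x distribution P Y]_z f z)%E.
  transitivity (\int[pushforward P J]_z f z)%E.
    by rewrite ge0_integral_pushforward.
  by apply: eq_measure_integral => D mD _; exact: (indep_joint H mD).
rewrite fubini_tonelli1//; apply: eq_integral => x _.
rewrite /fubini_F ge0_integral_pushforward//.
exact: measurableT_comp.
Qed.

(** An event on [Z] is a joint event of [X] and [Y]. Given the cylinder of all other variables the
    pair still has the product law, so this event factors out. *)
Lemma indep_seq_merge s1 s2 X Y Z (f : R * R -> R) :
  measurable_fun setT f -> (forall w, Z w = f (X w, Y w)) ->
  indep_seq (s1 ++ X :: Y :: s2) -> indep_seq (s1 ++ Z :: s2).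
Proof.
move=> mf ZE H l ls ml.
have [l1 [A [l2 [lE l1E l2E]]]] : exists l1 A l2,
    [/\ l = l1 ++ (Z, A) :: l2, map fst l1 = s1 & map fst l2 = s2].
  have := cat_take_drop (size s1) l.
  have h1 : map fst (take (size s1) l) = s1 by rewrite map_take ls take_size_cat.
  have : map fst (drop (size s1) l) = Z :: s2.
    by rewrite map_drop ls drop_size_cat.
  case: (drop _ _) => //= -[X' A] l2 [] /= XE l2E lE.
  by exists (take (size s1) l), A, l2; split => //; rewrite -XE lE.
move: ml; rewrite lE all_cat/= => /and3P[m1 /asboolP mA m2].
have H12 A1 A2 : measurable A1 -> measurable A2 ->
    P (cylinder (l1 ++ l2) `&` (X @^-1` A1 `&` Y @^-1` A2)) =
    (\prod_(p <- l1 ++ l2) P (p.1 @^-1` p.2) * (P (X @^-1` A1) * P (Y @^-1` A2)))%E.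
  move=> mA1 mA2; have := H (l1 ++ [:: (X, A1), (Y, A2) & l2]).
  rewrite map_cat/= l1E l2E => /(_ erefl); rewrite all_cat m1/= m2 !asboolT//.
  move=> /(_ isT); rewrite !big_cat/= !big_cons/= !cylinder_cat !cylinder_cons => E.
  rewrite -setIA (setIC (cylinder l2)) -!setIA E.
  by rewrite -!muleA; congr (_ * _)%E; rewrite [RHS]muleC -!muleA.
have mC : measurable (cylinder (l1 ++ l2)).
  by apply: measurable_cylinder; rewrite all_cat m1 m2.
have PC : P (cylinder (l1 ++ l2)) = (\prod_(p <- l1 ++ l2) P (p.1 @^-1` p.2))%E.
  have := H12 setT setT measurableT measurableT.
  by rewrite !preimage_setT !setIT probability_setT !mule1.
have XY : indep_seq [:: X; Y] by apply: (@indep_seq_mid s1 _ s2).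
have mD : measurable (f @^-1` A) by rewrite -[_ @^-1` _]setTI; exact: mf.
have ZA : Z @^-1` A = joint X Y @^-1` (f @^-1` A).
  by apply/seteqP; split => w /=; rewrite ZE.
rewrite cylinder_cat cylinder_cons big_cat big_cons/= setICA -cylinder_cat setIC.
rewrite muleCA -big_cat/= -PC ZA indep_joint_given//; last first.
  by move=> A1 A2 mA1 mA2; rewrite H12// PC.
by rewrite indep_joint// muleC.
Qed.

Lemma indep_seq_foldr (F : {mfun T >-> R} -> {mfun T >-> R} -> {mfun T >-> R})
    (f : R * R -> R) c s1 s s2 :
  measurable_fun setT f -> (forall X Y w, F X Y w = f (X w, Y w)) ->
  indep_seq (s1 ++ s ++ s2) -> indep_seq (s1 ++ foldr F (cst c : {mfun T >-> R}) s :: s2).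
Proof.
move=> mf FE; elim: s s1 => [|X s IH] s1 /= H; first exact: indep_seq_insert_cst.
apply: (@indep_seq_merge s1 s2 X (foldr F (cst c : {mfun T >-> R}) s) _ f) => //.
(* [X] is parked at the end of the left block while the tail is folded. *)
by have := IH (rcons s1 X); rewrite !cat_rcons => /(_ H).
Qed.

End independence.

(** * Maxima of random walks *)

Section lindley.
Context d (T : measurableType d) (R : realType) (P : probability T R).
Notation mu := (@lebesgue_measure R).
Implicit Types (X Y : {mfun T >-> R}) (s : seq {mfun T >-> R}) (x y e : R).

(* The largest of the sums of the prefixes of [s], the empty one included; the
   first-step recursion makes it a fold. *)
Definition lindley s : {mfun T >-> R} :=
  foldr (fun X M : {mfun T >-> R} => max_mfun (cst 0) (X \+ M)) (cst 0 : {mfun T >-> R}) s.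

Definition walk_sum s : {mfun T >-> R} :=
  foldr (fun X M : {mfun T >-> R} => X \+ M : {mfun T >-> R}) (cst 0 : {mfun T >-> R}) s.

Notation law := (distribution P).
Notation cdf := (@cdf _ _ _ P).
Notation ccdf := (@ccdf _ _ _ P).

Lemma lindley_cons X s w : lindley (X :: s) w = Num.max 0 (X w + lindley s w).
Proof. by []. Qed.

Lemma lindley_ge0 s w : 0 <= lindley s w.
Proof. by case: s => [|X s]//; rewrite lindley_cons le_max lexx. Qed.

Let measurable_maxadd : measurable_fun setT (fun z : R * R => Num.max 0 (z.1 + z.2)).
Proof. by apply: measurable_maxr => //; exact: measurable_funD. Qed.

Lemma indep_seq_lindley s1 s s2 :
  indep_seq P (s1 ++ s ++ s2) -> indep_seq P (s1 ++ lindley s :: s2).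
Proof.
exact: (@indep_seq_foldr _ _ _ P
  (fun X M : {mfun T >-> R} => max_mfun (cst 0) (X \+ M)) _ 0 _ _ _
  measurable_maxadd (fun _ _ _ => erefl)).
Qed.

Lemma indep_seq_walk_sum s1 s s2 :
  indep_seq P (s1 ++ s ++ s2) -> indep_seq P (s1 ++ walk_sum s :: s2).
Proof.
apply: (@indep_seq_foldr _ _ _ _ _ (fun z : R * R => z.1 + z.2)) => //.
exact: measurable_funD.
Qed.

Lemma indep_cons_lindley X s : indep_seq P (X :: s) -> indep_seq P [:: X; lindley s].
Proof. by move=> H; apply: (@indep_seq_lindley [:: X] s [::]); rewrite cats0. Qed.

Lemma indep_cons_walk_sum X s : indep_seq P (X :: s) -> indep_seq P [:: X; walk_sum s].
Proof. by move=> H; apply: (@indep_seq_walk_sum [:: X] s [::]); rewrite cats0. Qed.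

Lemma indep_behead X s : indep_seq P (X :: s) -> indep_seq P s.
Proof. by move=> H; apply: (@indep_seq_mid _ _ _ _ [:: X] _ [::]); rewrite cats0. Qed.

Lemma indep_prob X Y (D : set (R * R)) : indep_seq P [:: X; Y] -> measurable D ->
  P [set w | D (X w, Y w)] = (\int[law X]_x P [set w | D (x, Y w)])%E.
Proof.
move=> H mD; have := indep_joint H mD; rewrite /preimage/= => ->.
apply: eq_integral => x _; rewrite /= /distribution /pushforward/=; congr (P _).
by apply/seteqP; split => w; rewrite /xsection/= inE.
Qed.

Lemma cdf_addE X Y x : indep_seq P [:: X; Y] ->
  P [set w | X w + Y w <= x] = (\int[law X]_y cdf Y (x - y))%E.
Proof.
move=> H; have mD : measurable [set z : R * R | z.1 + z.2 <= x].
  have := @measurable_funD _ (R * R)%type R setT fst snd measurable_fst measurable_snd.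
  move=> /(_ measurableT `]-oo, x]%classic (measurable_itv _)); rewrite setTI.
  by congr measurable; apply/seteqP; split => z /=; rewrite in_itv.
rewrite (indep_prob H mD); apply: eq_integral => y _.
rewrite /cdf /distribution /pushforward/=; congr (P _); apply/seteqP.
by split => w /=; rewrite in_itv/=; lra.
Qed.

Lemma ccdf_addE X Y x : indep_seq P [:: X; Y] ->
  P [set w | x < X w + Y w] = (\int[law X]_y ccdf Y (x - y))%E.
Proof.
move=> H; have mD : measurable [set z : R * R | x < z.1 + z.2].
  have := @measurable_funD _ (R * R)%type R setT fst snd measurable_fst measurable_snd.
  move=> /(_ measurableT `]x, +oo[%classic (measurable_itv _)); rewrite setTI.
  by congr measurable; apply/seteqP; split => z /=; rewrite in_itv/= andbT.
rewrite (indep_prob H mD); apply: eq_integral => y _.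
rewrite /ccdf /distribution /pushforward/=; congr (P _); apply/seteqP.
by split => w /=; rewrite in_itv/= andbT; lra.
Qed.

Lemma cdf_lindley_cons X s x : 0 <= x -> indep_seq P (X :: s) ->
  cdf (lindley (X :: s)) x = (\int[law X]_y cdf (lindley s) (x - y))%E.
Proof.
move=> x0 H; rewrite -cdf_addE; last exact: indep_cons_lindley.
rewrite /cdf /distribution /pushforward; congr (P _); apply/seteqP.
by split => w /=; rewrite in_itv/= ge_max x0.
Qed.

Lemma ccdf_lindley_cons X s x : 0 <= x -> indep_seq P (X :: s) ->
  ccdf (lindley (X :: s)) x = (\int[law X]_y ccdf (lindley s) (x - y))%E.
Proof.
move=> x0 H; rewrite -ccdf_addE; last exact: indep_cons_lindley.
rewrite /ccdf /distribution /pushforward; congr (P _); apply/seteqP.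
by split => w /=; rewrite in_itv/= andbT lt_max [x < 0]ltNge x0.
Qed.

Lemma cdf_lindley_lt0 s x : x < 0 -> cdf (lindley s) x = 0%E.
Proof.
move=> x0; rewrite /cdf /distribution /pushforward.
rewrite (_ : _ @^-1` _ = set0) ?measure0//; apply/seteqP; split => w //=.
by rewrite in_itv/= => /(le_trans (lindley_ge0 s w)); rewrite leNgt x0.
Qed.

Lemma ccdf_lindley_lt0 s x : x < 0 -> ccdf (lindley s) x = 1%E.
Proof. by move=> x0; rewrite ccdf_1_cdf cdf_lindley_lt0// sube0. Qed.

Lemma ccdf_lindley_nil x : 0 <= x -> ccdf (lindley [::]) x = 0%E.
Proof.
move=> x0; rewrite /ccdf /distribution /pushforward.
rewrite (_ : _ @^-1` _ = set0) ?measure0//; apply/seteqP; split => w //=.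
by rewrite in_itv/= andbT ltNge x0.
Qed.

Lemma cdf_lindley_nil x : 0 <= x -> cdf (lindley [::]) x = 1%E.
Proof. by move=> x0; rewrite cdf_1_ccdf ccdf_lindley_nil// sube0. Qed.

Lemma measurable_ccdfB Y x : measurable_fun [set: R] (fun y => ccdf Y (x - y)).
Proof.
apply: (measurableT_comp (ccdf_measurable (P := P) Y)); exact: measurable_funB.
Qed.

Lemma measurable_cdfB Y x : measurable_fun [set: R] (fun y => cdf Y (x - y)).
Proof.
apply: (measurableT_comp (cdf_measurable (P := P) Y)); exact: measurable_funB.
Qed.

(** Lundberg's inequality without stopping times: since the mean of [expR (2 * y)] is 1, the
    function exp(-2x) is reproduced by averaging over the first step, and at negative levels it is
    at least 1, the value of the tail there. *)
Lemma ccdf_lindley_le s x : indep_seq P s ->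
  {in s, forall X, (\int[law X]_y (expR (2 * y))%:E = 1)%E} ->
  (ccdf (lindley s) x <= (expR (- (2 * x)))%:E)%E.
Proof.
elim: s x => [|X s IH] x H L; have [x0|x0] := ltP x 0.
- by rewrite ccdf_lindley_lt0// lee_fin -[leLHS]expR0 ler_expR; lra.
- by rewrite ccdf_lindley_nil// lee_fin expR_ge0.
- by rewrite ccdf_lindley_lt0// lee_fin -[leLHS]expR0 ler_expR; lra.
rewrite ccdf_lindley_cons//.
have LX : (\int[law X]_y (expR (2 * y))%:E = 1)%E by apply: L; rewrite inE eqxx.
rewrite -[leRHS]mule1 -LX -ge0_integralZl//; last first.
  by apply/measurable_EFinP; exact: measurable_expRM.
apply: ge0_le_integral => //.
- exact: measurable_ccdfB.
- apply: emeasurable_funM => //; apply/measurable_EFinP; exact: measurable_expRM.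
- move=> y _; rewrite -EFinM -expRD.
  rewrite (_ : - (2 * x) + 2 * y = - (2 * (x - y))); last by ring.
  apply: IH; first exact: indep_behead H.
  by move=> Y Ys; apply: L; rewrite inE Ys orbT.
Qed.

End lindley.

Section lindley_bounds.
Context d (T : measurableType d) (R : realType) (P : probability T R).
Notation mu := (@lebesgue_measure R).
Implicit Types (X Y : {mfun T >-> R}) (s : seq {mfun T >-> R}) (x y e : R).
Notation law := (distribution P).
Notation cdf := (@cdf _ _ _ P).
Notation ccdf := (@ccdf _ _ _ P).

(* [q] pays for the steps that overshoot the level by more than [e], the power
   of [r] for the walks that have not reached it yet. *)
Lemma ccdf_lindley_ge s x e (r q : R) : 0 <= x -> 0 <= e -> 0 <= r -> 0 <= q ->
  indep_seq P s ->
  {in s, forall X, (\int[law X]_y (expR (2 * y))%:E = 1)%E} ->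
  {in s, forall X, (\int[law X]_y (expR (1 * y))%:E <= r%:E)%E} ->
  {in s, forall X,
    (\int[law X]_y ((expR (2 * y))%:E * (\1_`]e, +oo[ y)%:E) <= q%:E)%E} ->
  ((expR (- (2 * (x + e))))%:E <= ccdf (lindley s) x
    + (r ^+ size s * expR (- (x + e)) + (size s)%:R * q)%:E)%E.
Proof.
move=> + e0 r0 q0; elim: s x => [|X s IH] x x0 H L1 L2 L3.
  rewrite ccdf_lindley_nil// add0e lee_fin expr0 mul1r mul0r addr0 ler_expR; lra.
have {}IH z : 0 <= z -> ((expR (- (2 * (z + e))))%:E <= ccdf (lindley s) z
    + (r ^+ size s * expR (- (z + e)) + (size s)%:R * q)%:E)%E.
  move=> z0; apply: IH => //; first exact: indep_behead H.
  - by move=> Y Ys; apply: L1; rewrite inE Ys orbT.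
  - by move=> Y Ys; apply: L2; rewrite inE Ys orbT.
  - by move=> Y Ys; apply: L3; rewrite inE Ys orbT.
have {}L1 := L1 X (mem_head X s).
have {}L2 := L2 X (mem_head X s).
have {}L3 := L3 X (mem_head X s).
set n := size s in IH *.
pose a := r ^+ n * expR (- (x + e)).
have a0 : 0 <= a by rewrite mulr_ge0 ?exprn_ge0 ?expR_ge0.
have me k : measurable_fun [set: R] (fun y => (expR (k * y))%:E).
  by apply/measurable_EFinP; exact: measurable_expRM.
have mi : measurable_fun [set: R] (fun y => (\1_`]e, +oo[%classic y : R)%:E).
  by apply/measurable_EFinP; exact: measurable_indic.
have n0 : 0 <= n%:R * q by rewrite mulr_ge0.
have h1 y : 0 <= a * expR (1 * y) by rewrite mulr_ge0// expR_ge0.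
have h2 y : 0 <= expR (2 * y) * \1_`]e, +oo[%classic y :> R.
  by rewrite mulr_ge0 ?expR_ge0.
rewrite ccdf_lindley_cons//.
apply: (@le_trans _ _ (\int[law X]_y (ccdf (lindley s) (x - y) +
    ((a%:E * (expR (1 * y))%:E + (n%:R * q)%:E) +
     (expR (2 * y))%:E * (\1_`]e, +oo[ y)%:E)))%E).
  (* [L1] turns the left side into a mean over the first step, so that the comparison becomes
     pointwise. *)
  rewrite -[leLHS]mule1 -L1 -ge0_integralZl//.
  apply: ge0_le_integral => //.
  - exact: emeasurable_funM.
  - apply: emeasurable_funD; first exact: measurable_ccdfB.
    apply: emeasurable_funD; last exact: emeasurable_funM.
    by apply: emeasurable_funD => //; exact: emeasurable_funM.
  move=> y _; rewrite -!EFinM -EFinD -expRD.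
  rewrite (_ : - (2 * (x + e)) + 2 * y = - (2 * (x - y + e))); last by ring.
  have ae : a * expR (1 * y) = r ^+ n * expR (- (x - y + e)).
    by rewrite /a -mulrA -expRD; congr (_ * expR _); ring.
  have [xy|xy] := leP 0 (x - y).
    apply: (le_trans (IH _ xy)); rewrite leeD2l// lee_fin ae.
    by rewrite lerDl mulr_ge0// expR_ge0.
  rewrite ccdf_lindley_lt0// -EFinD lee_fin indicE mem_setE/= in_itv/= andbT.
  have [ey|ey] := ltP e y.
    rewrite mulr1 addrA; apply: ler_wpDl.
      by rewrite !addr_ge0// mulr_ge0// expR_ge0.
    rewrite ler_expR (_ : - _ = 2 * y - 2 * (x + e)); last by ring.
    by rewrite gerBl mulr_ge0// addr_ge0.
  (* Here [y <= e], so [x - y + e] is nonnegative and the left side is at most 1, the value of the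
     tail below 0. *)
  rewrite mulr0 addr0; apply: ler_wpDr; first by rewrite addr_ge0// mulr_ge0// expR_ge0.
  rewrite -[leRHS]expR0 ler_expR oppr_le0 mulr_ge0// addrAC subr_ge0.
  by rewrite ler_wpDl.
rewrite ge0_integralD//; last 3 first.
- exact: measurable_ccdfB.
- by move=> y _; rewrite -!EFinM -!EFinD lee_fin !addr_ge0.
- apply: emeasurable_funD; last exact: emeasurable_funM.
  by apply: emeasurable_funD => //; exact: emeasurable_funM.
rewrite leeD2l// ge0_integralD//; last 3 first.
- by move=> y _; rewrite -!EFinM -!EFinD lee_fin !addr_ge0.
- by apply: emeasurable_funD => //; exact: emeasurable_funM.
- exact: emeasurable_funM.
rewrite ge0_integralD//; last 2 first.
- by move=> y _; rewrite -EFinM lee_fin.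
- exact: emeasurable_funM.
rewrite ge0_integralZl// integral_probability_cst.
apply: (@le_trans _ _ ((a%:E * r%:E + (n%:R * q)%:E) + q%:E)%E).
  by rewrite leeD// leeD2r// lee_wpmul2l.
rewrite -EFinM -!EFinD lee_fin /=.
suff -> : a * r + n%:R * q + q = r ^+ n.+1 * expR (- (x + e)) + n.+1%:R * q by [].
by rewrite /a mulrAC -exprSr -natr1 mulrDl mul1r addrA.
Qed.

(** This is V plus 1, as a mean over the walk itself rather than over a normal law, so that
    conditioning on the first step makes sense. *)
Definition mean_odd_step s x : \bar R :=
  (\int[P]_w (odd_step (x - walk_sum s w))%:E)%E.

Let measurable_pair s :
  measurable_fun [set: R * T] (fun z => (odd_step (z.1 - walk_sum s z.2))%:E).
Proof.
apply/measurable_EFinP.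
apply: (@measurableT_comp _ _ _ _ _ _ (@odd_step R)).
  exact: measurable_odd_step.
apply: measurable_funB => //; exact: measurableT_comp.
Qed.

Lemma mean_odd_step_ge0 s x : (0 <= mean_odd_step s x)%E.
Proof. by apply: integral_ge0 => w _; rewrite lee_fin odd_step_ge0. Qed.

Lemma measurable_mean_odd_step s : measurable_fun [set: R] (mean_odd_step s).
Proof.
apply: (measurable_fun_fubini_tonelli_F (m2 := P) _ (measurable_pair s)).
by move=> z; rewrite lee_fin odd_step_ge0.
Qed.

Lemma mean_odd_step_nil x : mean_odd_step [::] x = (odd_step x)%:E.
Proof.
rewrite /mean_odd_step; under eq_integral do rewrite /= subr0.
exact: integral_probability_cst.
Qed.

Lemma mean_odd_step_cons X s x : indep_seq P (X :: s) ->
  mean_odd_step (X :: s) x = (\int[law X]_y mean_odd_step s (x - y))%E.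
Proof.
move=> /indep_cons_walk_sum H.
pose f (z : R * R) := (odd_step (x - (z.1 + z.2)))%:E.
rewrite /mean_odd_step.
transitivity (\int[law X]_y \int[P]_w f (y, walk_sum s w))%E.
  rewrite -indep_integral//.
    apply/measurable_EFinP.
    apply: (@measurableT_comp _ _ _ _ _ _ (@odd_step R)).
      exact: measurable_odd_step.
    by apply: measurable_funB => //; exact: measurable_funD.
  by move=> z; rewrite lee_fin odd_step_ge0.
by apply: eq_integral => y _; apply: eq_integral => w _; rewrite /f/= opprD addrA.
Qed.

(* Suffixes of [s] are what the first-step induction meets. *)
Definition signed_means s := forall k x,
  ((0 <= x)%R -> (1 <= mean_odd_step (drop k s) x)%E) /\
  ((x <= 0)%R -> (mean_odd_step (drop k s) x <= 1)%E).

(** V obeys the first-step recursion at every level, the distribution function of the maximum only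
    at nonnegative ones. At negative levels the latter is 0 and V is at most 0, so V can only be
    smaller. *)
Lemma mean_odd_step_le s x : indep_seq P s -> signed_means s ->
  (mean_odd_step s x <= 1 + cdf (lindley s) x)%E.
Proof.
elim: s x => [|X s IH] x H sg; have [x0|x0] := ltP x 0.
- rewrite cdf_lindley_lt0// adde0; have [_] := sg 0%N x; rewrite drop0; apply; exact: ltW.
- rewrite mean_odd_step_nil cdf_lindley_nil// -EFinD lee_fin.
  have [->|xn0] := eqVneq x 0; first by rewrite odd_step0; lra.
  by rewrite odd_step_gt0// lt0r xn0.
- rewrite cdf_lindley_lt0// adde0; have [_] := sg 0%N x; rewrite drop0; apply; exact: ltW.
have mB : measurable_fun [set: R] (fun y => mean_odd_step s (x - y)).
  by apply: (measurableT_comp (measurable_mean_odd_step s)); exact: measurable_funB.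
rewrite mean_odd_step_cons// cdf_lindley_cons//.
rewrite -[X in (_ <= X + _)%E](integral_probability_cst (law X)).
rewrite -ge0_integralD//; last exact: measurable_cdfB.
apply: ge0_le_integral => //.
- by move=> y _; exact: mean_odd_step_ge0.
- by apply: emeasurable_funD => //; exact: measurable_cdfB.
move=> y _; apply: IH; first exact: indep_behead H.
by move=> k z; exact: (sg k.+1 z).
Qed.

Lemma mean_odd_step_ge s x e (p : R) : 0 <= x -> 0 < e -> 0 <= p ->
  indep_seq P s -> signed_means s ->
  {in s, forall X, (law X `]e, +oo[ <= p%:E)%E} ->
  (1 + cdf (lindley s) x <= mean_odd_step s (x + e) + ((size s)%:R * p)%:E)%E.
Proof.
move=> + e0 p0; elim: s x => [|X s IH] x x0 H sg L.
  by rewrite mean_odd_step_nil cdf_lindley_nil// mul0r adde0 odd_step_gt0 ?ltr_wpDl//.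
have {}IH z : 0 <= z -> (1 + cdf (lindley s) z <=
    mean_odd_step s (z + e) + ((size s)%:R * p)%:E)%E.
  move=> z0; apply: (IH _ z0 (indep_behead H)) => [k z'|Y Ys].
    exact: (sg k.+1 z').
  by apply: L; rewrite inE Ys orbT.
have {}L := L X (mem_head X s).
have np0 : 0 <= (size s)%:R * p by rewrite mulr_ge0.
have mB : measurable_fun [set: R] (fun y => mean_odd_step s (x + e - y)).
  by apply: (measurableT_comp (measurable_mean_odd_step s)); exact: measurable_funB.
have mi : measurable_fun [set: R] (fun y => (\1_`]e, +oo[%classic y : R)%:E).
  by apply/measurable_EFinP; exact: measurable_indic.
rewrite mean_odd_step_cons// cdf_lindley_cons//.
rewrite -[X in (X + _ <= _)%E](integral_probability_cst (law X)).
rewrite -ge0_integralD//; last exact: measurable_cdfB.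
apply: (@le_trans _ _ (\int[law X]_y (mean_odd_step s (x + e - y) +
    ((cst ((size s)%:R * p)%:E y) + (\1_`]e, +oo[%classic y)%:E)))%E).
  apply: ge0_le_integral => //.
  - by move=> y _; rewrite adde_ge0// cdf_ge0.
  - by apply: emeasurable_funD => //; exact: measurable_cdfB.
  - by apply: emeasurable_funD => //; exact: emeasurable_funD.
  move=> y _; have [xy|xy] := leP 0 (x - y).
    apply: (le_trans (IH _ xy)); rewrite (_ : x - y + e = x + e - y); last by ring.
    by rewrite leeD2l// leeDl// lee_fin.
  rewrite cdf_lindley_lt0// adde0 /= -EFinD indicE mem_setE/= in_itv/= andbT.
  (* A step beyond [e] is paid by the indicator, since [odd_step] has nonnegative mean. A step of at
     most [e] leaves [x + e - y] above [x], hence nonnegative, where the mean is at least 1. *)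
  have [ey|ey] := ltP e y.
    by rewrite -[leLHS]add0e leeD ?mean_odd_step_ge0// lee_fin lerDr.
  rewrite addr0 -[leLHS]adde0 leeD ?lee_fin//.
  have [+ _] := sg 1%N (x + e - y); rewrite /= drop0; apply; lra.
rewrite ge0_integralD//; last 3 first.
- by move=> y _; exact: mean_odd_step_ge0.
- by move=> y _; rewrite -EFinD lee_fin addr_ge0.
- exact: emeasurable_funD.
rewrite leeD2l// ge0_integralD// integral_probability_cst.
rewrite integral_indic// setIT -natr1 mulrDl mul1r EFinD leeD2l//.
Qed.

(** By Fubini, both sides are the probability that [M] is at most an independent exponential
    variable of rate 2. *)
Lemma integral_cdf_exponential (M : {mfun T >-> R}) : (forall w, 0 <= M w) ->
  (\int[mu]_x (cdf M x * (exponential_pdf 2 x)%:E) =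
   \int[P]_w (expR (- (2 * M w)))%:E)%E.
Proof.
move=> M0.
have mpsi : measurable_fun [set: R] (@exponential_pdf R 2).
  exact: measurable_exponential_pdf.
pose f (z : R * T) := (\1_`]-oo, 0]%classic (M z.2 - z.1) * exponential_pdf 2 z.1)%:E.
have mf : measurable_fun setT f.
  apply/measurable_EFinP; apply: measurable_funM; last exact: measurableT_comp.
  apply: (@measurableT_comp _ _ _ _ _ _ (\1_`]-oo, 0]%classic : R -> R)).
    exact: measurable_indic.
  by apply: measurable_funB => //; exact: measurableT_comp.
have f0 z : (0 <= f z)%E by rewrite lee_fin mulr_ge0// exponential_pdf_ge0.
transitivity (\int[mu]_x \int[P]_w f (x, w))%E.
  apply: eq_integral => x _.
  have mMx : measurable (M @^-1` `]-oo, x]%classic).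
    by rewrite -[_ @^-1` _]setTI; exact: measurable_funPT.
  transitivity (\int[P]_w ((\1_(M @^-1` `]-oo, x]%classic) w)%:E * (exponential_pdf 2 x)%:E))%E.
    rewrite ge0_integralZr//.
    - by rewrite integral_indic// setIT.
    - by apply/measurable_EFinP; exact: measurable_indic.
    - by rewrite lee_fin exponential_pdf_ge0.
  apply: eq_integral => w _; rewrite -EFinM /f/=; congr (_ * _)%:E.
  rewrite !indicE; congr (_%:R); congr nat_of_bool.
  by apply/idP/idP; rewrite !inE/= !in_itv/= subr_le0.
rewrite [LHS](@fubini_tonelli _ _ _ _ R mu P f mf f0); apply: eq_integral => w _.
rewrite -exponential_pdf_tail_cy//; apply: eq_integral => x _.
rewrite /f/=; congr (_ * _)%:E; rewrite !indicE; congr (_%:R); congr nat_of_bool.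
by apply/idP/idP; rewrite !inE/= !in_itv/= andbT subr_le0.
Qed.

End lindley_bounds.

(* [R] and [measurableTypeR R] carry the same sigma-algebra under different
   displays, so their integrals are not convertible. *)
Lemma ge0_integral_measurableTypeR (R : realType) (m1 : {measure set R -> \bar R})
    (m2 : {measure set (measurableTypeR R) -> \bar R}) (f : R -> \bar R) :
  measurable_fun [set: R] f -> (forall x, 0 <= f x)%E ->
  (forall A, measurable A -> m1 A = m2 A) ->
  (\int[m1]_x f x = \int[m2]_x f x)%E.
Proof.
move=> mf f0 m12.
have mid : measurable_fun setT (id : measurableTypeR R -> R) by [].
transitivity (\int[pushforward m2 (id : measurableTypeR R -> R)]_x f x)%E.
  by apply: eq_measure_integral => // A mA _; exact: m12.
by rewrite ge0_integral_pushforward.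
Qed.

(** * Laplace transform of the maximum and gap probability *)

Section sandwich.
Context d (T : measurableType d) (R : realType) (P : probability T R).
Notation mu := (@lebesgue_measure R).
Implicit Types (X Y Q M : {mfun T >-> R}) (s : seq {mfun T >-> R}) (x y e t u : R).
Notation law := (distribution P).
Notation cdf := (@cdf _ _ _ P).
Notation ccdf := (@ccdf _ _ _ P).
Notation psi := (@exponential_pdf R 2).

Let psi0 x : 0 <= psi x.
Proof. exact: exponential_pdf_ge0. Qed.

Let mpsi : measurable_fun [set: R] (fun x => (psi x)%:E).
Proof. by apply/measurable_EFinP; exact: measurable_exponential_pdf. Qed.

(** The value of E exp(-2M) for M the maximum of -Y on [0, t]. *)
Definition mean_exp_max t : R :=
  2 * (1 + t) * normal_tail (Num.sqrt t) - Num.sqrt (2 * t / pi) * expR (- t / 2).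

(** Only the law of the total sum enters, so the value is exact for every mesh; discretisation
    errors arise solely in comparing V with the distribution function of the maximum. *)
Lemma integral_mean_odd_step s t : 0 < t ->
  (forall A, measurable A -> law (walk_sum s) A = normal_prob t (Num.sqrt t) A) ->
  (\int[mu]_x (mean_odd_step P s x * (psi x)%:E) = (1 + mean_exp_max t)%:E)%E.
Proof.
move=> t0 L.
pose f (z : R * T) := (odd_step (z.1 - walk_sum s z.2) * psi z.1)%:E.
have mf : measurable_fun setT f.
  apply/measurable_EFinP; apply: measurable_funM; last first.
    apply: measurableT_comp => //; exact: measurable_exponential_pdf.
  apply: (@measurableT_comp _ _ _ _ _ _ (@odd_step R)).
    exact: measurable_odd_step.
  by apply: measurable_funB => //; exact: measurableT_comp.
have f0 z : (0 <= f z)%E by rewrite lee_fin mulr_ge0// odd_step_ge0.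
transitivity (\int[mu]_x \int[P]_w f (x, w))%E.
  apply: eq_integral => x _; rewrite /mean_odd_step -ge0_integralZr//.
  - apply/measurable_EFinP.
    apply: (@measurableT_comp _ _ _ _ _ _ (@odd_step R)).
      exact: measurable_odd_step.
    exact: measurable_funB.
  - by move=> w _; rewrite lee_fin odd_step_ge0.
  - by rewrite lee_fin.
rewrite [LHS](@fubini_tonelli _ _ _ _ R mu P f mf f0).
rewrite -integral_odd_step_exponential_normal//.
have mg : measurable_fun [set: R]
    (fun y => \int[mu]_x (odd_step (x - y) * psi x)%:E)%E.
  pose g (z : R * R) := (odd_step (z.2 - z.1) * psi z.2)%:E.
  apply: (@measurable_fun_fubini_tonelli_F _ _ _ _ R mu g).
    apply/measurable_EFinP; apply: measurable_funM; last first.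
      by apply: measurableT_comp => //; exact: measurable_exponential_pdf.
    apply: (@measurableT_comp _ _ _ _ _ _ (@odd_step R)).
      exact: measurable_odd_step.
    exact: measurable_funB.
  by move=> z; rewrite lee_fin mulr_ge0// odd_step_ge0.
transitivity (\int[law (walk_sum s)]_y \int[mu]_x (odd_step (x - y) * psi x)%:E)%E.
  rewrite ge0_integral_pushforward// => y _.
  by apply: integral_ge0 => x _; rewrite lee_fin mulr_ge0// odd_step_ge0.
apply: ge0_integral_measurableTypeR => //.
by move=> y; apply: integral_ge0 => x _; rewrite lee_fin mulr_ge0// odd_step_ge0.
Qed.

Lemma expectation_lindley_ge s t : 0 < t -> indep_seq P s -> signed_means P s ->
  (forall A, measurable A -> law (walk_sum s) A = normal_prob t (Num.sqrt t) A) ->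
  ((mean_exp_max t)%:E <= \int[P]_w (expR (- (2 * lindley s w)))%:E)%E.
Proof.
move=> t0 H sg L; rewrite -(leeD2lE (x := 1%E))// -EFinD -(integral_mean_odd_step t0 L).
rewrite -integral_cdf_exponential; last exact: lindley_ge0.
rewrite -[X in (_ <= X + _)%E]integral_exponential_pdf2.
have mc : measurable_fun [set: R] (fun x => cdf (lindley s) x * (psi x)%:E)%E.
  by apply: emeasurable_funM => //; exact: cdf_measurable.
rewrite -ge0_integralD//; last 2 first.
- by move=> x _; rewrite lee_fin.
- by move=> x _; rewrite mule_ge0 ?lee_fin ?cdf_ge0.
apply: ge0_le_integral => //.
- by move=> x _; rewrite mule_ge0 ?lee_fin ?mean_odd_step_ge0.
- by apply: emeasurable_funM => //; exact: measurable_mean_odd_step.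
- exact: emeasurable_funD.
move=> x _; rewrite -[X in (_ <= X + _)%E]mul1e -ge0_muleDl//.
by rewrite lee_wpmul2r ?lee_fin// mean_odd_step_le.
Qed.

Lemma expectation_lindley_le s t e (p : R) : 0 < t -> 0 < e -> 0 <= p ->
  indep_seq P s -> signed_means P s ->
  {in s, forall X, (law X `]e, +oo[ <= p%:E)%E} ->
  (forall A, measurable A -> law (walk_sum s) A = normal_prob t (Num.sqrt t) A) ->
  (1 + \int[P]_w (expR (- (2 * lindley s w)))%:E <=
   (expR (2 * e) * (1 + mean_exp_max t) + (size s)%:R * p)%:E)%E.
Proof.
move=> t0 e0 p0 H sg Lp L.
rewrite -integral_cdf_exponential; last exact: lindley_ge0.
rewrite -[X in (X + _ <= _)%E]integral_exponential_pdf2.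
have mc : measurable_fun [set: R] (fun x => cdf (lindley s) x * (psi x)%:E)%E.
  by apply: emeasurable_funM => //; exact: cdf_measurable.
have mU := measurable_mean_odd_step P s.
have mUe : measurable_fun [set: R] (fun x => mean_odd_step P s (x + e)).
  by apply: (measurableT_comp mU); exact: measurable_funD.
have np0 : 0 <= (size s)%:R * p by rewrite mulr_ge0.
rewrite EFinD EFinM -(integral_mean_odd_step t0 L).
apply: (@le_trans _ _ (\int[mu]_x (mean_odd_step P s (x + e) * (psi x)%:E) +
    ((size s)%:R * p)%:E * \int[mu]_x (psi x)%:E)%E); last first.
  rewrite integral_exponential_pdf2 mule1 leeD2r//.
  apply: exponential_pdf_shift_le => //; first exact: ltW.
  by move=> x; exact: mean_odd_step_ge0.
rewrite -ge0_integralZl//; last by move=> x _; rewrite lee_fin.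
rewrite -!ge0_integralD//; last 6 first.
- by move=> x _; rewrite mule_ge0 ?lee_fin ?mean_odd_step_ge0.
- exact: emeasurable_funM.
- by move=> x _; rewrite mule_ge0 ?lee_fin.
- exact: emeasurable_funM.
- by move=> x _; rewrite lee_fin.
- by move=> x _; rewrite mule_ge0 ?lee_fin ?cdf_ge0.
apply: ge0_le_integral => //.
- by move=> x _; rewrite adde_ge0 ?mule_ge0 ?lee_fin ?cdf_ge0.
- exact: emeasurable_funD.
- by apply: emeasurable_funD; exact: emeasurable_funM.
move=> x _; have [x0|x0] := ltP x 0.
  by rewrite lt0_exponential_pdf// !mule0.
rewrite -[X in (X + _ <= _)%E]mul1e -ge0_muleDl// -ge0_muleDl ?mean_odd_step_ge0 ?lee_fin//.
by rewrite lee_wpmul2r ?lee_fin// mean_odd_step_ge.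
Qed.

Let measurable_shifted u : measurable [set z : R * R | u + z.1 < z.2].
Proof.
have := @measurable_funB _ (R * R)%type R setT snd fst measurable_snd measurable_fst.
move=> /(_ measurableT `]u, +oo[%classic (measurable_itv _)); rewrite setTI.
by congr measurable; apply/seteqP; split => z /=; rewrite in_itv/= andbT; lra.
Qed.

Lemma gap_probE M Q u : indep_seq P [:: M; Q] ->
  P [set w | u + M w < Q w] = (\int[P]_w ccdf Q (u + M w))%E.
Proof.
move=> H; rewrite (indep_prob H (measurable_shifted u)).
transitivity (\int[law M]_m ccdf Q (u + m))%E.
  apply: eq_integral => m _; rewrite /ccdf /distribution /pushforward/=.
  by congr (P _); apply/seteqP; split => w /=; rewrite in_itv/= andbT.
rewrite ge0_integral_pushforward//.
apply: (measurableT_comp (ccdf_measurable (P := P) Q)); exact: measurable_funD.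
Qed.

Let measurable_expN M k : measurable_fun setT (fun w => (expR (- (2 * (k + M w))))%:E).
Proof.
apply/measurable_EFinP; apply: measurableT_comp => //; apply: measurableT_comp => //.
by apply: measurable_funM => //; exact: measurable_funD.
Qed.

Let integral_expN M k : (\int[P]_w (expR (- (2 * (k + M w))))%:E =
  (expR (- (2 * k)))%:E * \int[P]_w (expR (- (2 * M w)))%:E)%E.
Proof.
rewrite -ge0_integralZl//.
- by apply: eq_integral => w _; rewrite -EFinM -expRD mulrDr opprD.
- by have := measurable_expN M 0; under eq_fun do rewrite add0r.
Qed.

Lemma gap_prob_le M Q u : indep_seq P [:: M; Q] ->
  (forall x, ccdf Q x <= (expR (- (2 * x)))%:E)%E ->
  (P [set w | (u + M w < Q w)%R] <=
   (expR (- (2 * u)))%:E * \int[P]_w (expR (- (2 * M w)))%:E)%E.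
Proof.
move=> H le; rewrite gap_probE// -integral_expN.
apply: ge0_le_integral => //.
by apply: (measurableT_comp (ccdf_measurable (P := P) Q)); exact: measurable_funD.
Qed.

Lemma gap_prob_ge M Q u e (c : R) : 0 <= u -> 0 <= c -> (forall w, 0 <= M w) ->
  indep_seq P [:: M; Q] ->
  (forall x, (0 <= x)%R -> (expR (- (2 * (x + e))))%:E <= ccdf Q x + c%:E)%E ->
  ((expR (- (2 * (u + e))))%:E * \int[P]_w (expR (- (2 * M w)))%:E <=
   P [set w | (u + M w < Q w)%R] + c%:E)%E.
Proof.
move=> u0 c0 M0 H ge; rewrite gap_probE// -integral_expN.
have mc : measurable_fun setT (fun w => ccdf Q (u + M w)).
  by apply: (measurableT_comp (ccdf_measurable (P := P) Q)); exact: measurable_funD.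
rewrite -[X in (_ <= _ + X)%E](integral_probability_cst P) -ge0_integralD//.
apply: ge0_le_integral => //; first exact: emeasurable_funD.
by move=> w _; rewrite addrAC; apply: ge; rewrite addr_ge0.
Qed.

End sandwich.

(** * Brownian motion along grids *)

Section mutual.
Context d (T : measurableType d) (R : realType) (P : probability T R).

(** Increments are numbered along time, whereas the past walk runs backwards from 0; the enumeration
    [r] reconciles the two orders. *)
Lemma mutually_independent_indep_seq n (D Z : nat -> {mfun T >-> R})
    (phi : nat -> R -> R) (r : seq nat) :
  mutually_independent P (fun i : 'I_n => D i) ->
  (forall j, measurable_fun setT (phi j)) ->
  (forall j w, Z j w = phi j (D j w)) ->
  uniq r -> all (fun j => j < n)%N r -> indep_seq P [seq Z j | j <- r].
Proof.
move=> H mphi ZE ur rn l ls ml.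
pose A j := nth setT (map snd l) (index j r).
have szl : size l = size r by rewrite -(size_map fst) ls size_map.
have mA j : measurable (A j).
  rewrite /A; have [jl|jl] := ltnP (index j r) (size l).
    rewrite (nth_map ((cst 0 : {mfun T >-> R}), setT))//.
    by move: ml => /all_nthP => /(_ ((cst 0 : {mfun T >-> R}), setT) _ jl) /asboolP.
  by rewrite nth_default// size_map.
have lE : l = [seq (Z j, A j) | j <- r].
  apply: (@eq_from_nth _ ((cst 0 : {mfun T >-> R}), setT)); first by rewrite size_map.
  move=> i il; have ir : (i < size r)%N by rewrite -szl.
  rewrite (nth_map 0%N)// /A index_uniq// [LHS]surjective_pairing; congr (_, _).
    rewrite -(nth_map 0%N (cst 0 : {mfun T >-> R}) Z)// -ls.
    by rewrite (nth_map ((cst 0 : {mfun T >-> R}), setT)).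
  by rewrite (nth_map ((cst 0 : {mfun T >-> R}), setT)).
rewrite /cylinder lE !big_map/=.
(* The value [setT] outside [r] extends the constraints to all [n] increments without changing the
   event. *)
pose A' (i : nat) : set R := if i \in r then phi i @^-1` A i else setT.
have mA' (i : 'I_n) : measurable (A' i).
  rewrite /A'; case: ifPn => // _; rewrite -[_ @^-1` _]setTI; exact: mphi.
have ZA j : Z j @^-1` A j = D j @^-1` (phi j @^-1` A j).
  by apply/seteqP; split => w /=; rewrite ZE.
have := H (fun i : 'I_n => A' i) mA'.
have -> : [set w | forall i : 'I_n, A' i (D i w)] =
    \big[setI/setT]_(j <- r) (Z j @^-1` A j).
  rewrite -bigcap_seq; apply/seteqP; split => w /=.
    move=> h j /= jr; have jn : (j < n)%N by move/allP : rn => /(_ j jr).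
    by have := h (Ordinal jn); rewrite /A'/= jr ZE.
  move=> h i; rewrite /A'; case: ifPn => // ir.
  by have := h i ir; rewrite /= ZE.
move=> ->.
rewrite -(big_mkord xpredT (fun i => P (D i @^-1` A' i))).
transitivity (\prod_(0 <= i < n | i \in r) P (Z i @^-1` A i))%E.
  rewrite [RHS]big_mkcond/=; apply: eq_bigr => i _; rewrite /A'; case: ifPn => // _.
    by rewrite ZA.
  by rewrite preimage_setT probability_setT.
rewrite -[LHS]big_filter (perm_big r) //. apply: uniq_perm => //.
  by rewrite filter_uniq// iota_uniq.
move=> j; rewrite mem_filter mem_index_iota /=.
have [jr|//] := boolP (j \in r).
by move/allP : rn => /(_ j jr) ->.
Qed.

End mutual.

Section telescope.
Context d (T : measurableType d) (R : realType).

Lemma walk_sum_telescope (X : nat -> {mfun T >-> R}) (f : nat -> T -> R) a n w :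
  (forall i, X i w = f i.+1 w - f i w) ->
  walk_sum [seq X i | i <- iota a n] w = f (a + n)%N w - f a w.
Proof.
move=> XE; elim: n a => [|n IH] a /=; first by rewrite addn0 subrr.
rewrite IH XE addSnnS; ring.
Qed.

End telescope.

Section brownian_grid.
Context d (T : measurableType d) (R : realType) (P : probability T R).
Variables (B : R -> {RV P >-> R}) (hB : two_sided_brownian_motion B).
Notation law := (distribution P).
Implicit Types (h k e u : R).

(** Both walks follow -Y away from time 0: the past one has drift -1 and its maximum approximates
    Q(0), the future one has drift 1. Independence is read off this form by increments of [B],
    telescoping off [past_stepE] and [future_stepE]. *)
Definition past_step h (i : nat) : {mfun T >-> R} :=
  (B (- (i%:R * h)) \- B (- (i.+1%:R * h))) \- cst h.

Definition future_step k (i : nat) : {mfun T >-> R} :=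
  cst k \- (B (i.+1%:R * k) \- B (i%:R * k)).

Lemma past_stepE h i w : past_step h i w =
  - drifted B (- (i.+1%:R * h)) w - - drifted B (- (i%:R * h)) w.
Proof. by rewrite /past_step /drifted /= -natr1; ring. Qed.

Lemma future_stepE k i w : future_step k i w =
  - drifted B (i.+1%:R * k) w - - drifted B (i%:R * k) w.
Proof. by rewrite /future_step /drifted /= -natr1; ring. Qed.

Lemma law_past_step h i (A : set R) : 0 < h -> measurable A ->
  law (past_step h i) A = normal_prob (- h) (Num.sqrt h) A.
Proof.
move=> h0 mA; have hi : - (i.+1%:R * h) < - (i%:R * h).
  by rewrite ltrN2 ltr_pM2r// ltr_nat.
rewrite -[- h]add0r -normal_prob_shift ?gt_eqF ?sqrtr_gt0//.
have := bm_gaussian_increments hB hi.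
rewrite (_ : - (i%:R * h) - - (i.+1%:R * h) = h); last by rewrite -natr1; ring.
move=> <-//; rewrite -[_ @^-1` _]setTI; exact: measurable_funD.
Qed.

Lemma law_future_sum k a n (A : set R) : 0 < k -> (0 < n)%N -> measurable A ->
  law (walk_sum [seq future_step k i | i <- iota a n]) A =
  normal_prob (n%:R * k) (Num.sqrt (n%:R * k)) A.
Proof.
move=> k0 n0 mA; have nk0 : 0 < n%:R * k by rewrite mulr_gt0// ltr0n.
have hi : a%:R * k < (a + n)%:R * k by rewrite ltr_pM2r// ltr_nat -addn1 leq_add2l.
rewrite -[X in normal_prob X _]subr0 -normal_prob_reflect ?gt_eqF ?sqrtr_gt0//.
have := bm_gaussian_increments hB hi.
rewrite (_ : (a + n)%:R * k - a%:R * k = n%:R * k); last by rewrite natrD; ring.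
move=> <-//; last first.
  by rewrite -[_ @^-1` _]setTI; exact: measurable_funB.
rewrite /distribution /pushforward; congr (P _).
have E w : walk_sum [seq future_step k i | i <- iota a n] w =
    n%:R * k - (B ((a + n)%:R * k) w - B (a%:R * k) w).
  rewrite (@walk_sum_telescope _ _ _ (future_step k)
    (fun i w => - drifted B (i%:R * k) w)); last first.
    by move=> i; exact: (future_stepE k i w).
  by rewrite /drifted natrD; ring.
by apply/seteqP; split => w /=; rewrite E.
Qed.

Lemma law_future_step k i (A : set R) : 0 < k -> measurable A ->
  law (future_step k i) A = normal_prob k (Num.sqrt k) A.
Proof.
move=> k0 mA; rewrite -[X in normal_prob X _]mul1r -[X in normal_prob _ (Num.sqrt X)]mul1r.
rewrite -(@law_future_sum k i 1)// /distribution /pushforward; congr (P _).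
by apply/seteqP; split => w /=; rewrite addr0.
Qed.

Lemma indep_future_past h k N n : 0 < h -> 0 < k ->
  indep_seq P ([seq future_step k i | i <- iota 0 n] ++
               [seq past_step h i | i <- iota 0 N]).
Proof.
move=> h0 k0.
(* A single increasing sequence of times carries both grids, with time 0 at index [N]. *)
pose tt (j : nat) : R := if (j <= N)%N then - ((N - j)%:R * h) else (j - N)%:R * k.
have ttm : {homo tt : i j / (i <= j)%N >-> i <= j}.
  move=> i j ij; rewrite /tt; case: ifPn => iN; case: ifPn => jN.
  - by rewrite lerN2 ler_pM2r// ler_nat leq_sub2l.
  - by apply: (@le_trans _ _ 0); rewrite ?oppr_le0 mulr_ge0// ltW.
  - by rewrite (leq_trans ij jN) in iN.
  - by rewrite ler_pM2r// ler_nat leq_sub2r.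
have ttF i : tt (N + i)%N = i%:R * k.
  rewrite /tt addKn; case: ifPn => //; rewrite -{2}(addn0 N) leq_add2l leqn0 => /eqP ->.
  by rewrite addn0 subnn !mul0r oppr0.
pose D j : {mfun T >-> R} := B (tt j.+1) \- B (tt j).
pose Z j : {mfun T >-> R} := if (j < N)%N then (D j \- cst h : {mfun T >-> R}) else cst k \- D j.
pose phi j : R -> R := if (j < N)%N then (fun x => x - h) else (fun x => k - x).
(* Future step [i] is increment [N + i]; past step [i] is increment [N - i.+1], as the past is read
   backwards. *)
pose r := [seq (N + i)%N | i <- iota 0 n] ++ [seq (N - i.+1)%N | i <- iota 0 N].
have -> : [seq future_step k i | i <- iota 0 n] ++ [seq past_step h i | i <- iota 0 N] =
    [seq Z j | j <- r].
  rewrite /r map_cat -!map_comp; congr (_ ++ _).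
    apply: eq_map => i /=; rewrite /Z ltnNge leq_addr/= /D -addnS !ttF//.
  apply/eq_in_map => i; rewrite mem_iota add0n /= => iN.
  rewrite /Z /D ltn_subrL (leq_ltn_trans (leq0n i) iN)/= /tt leq_subr subKn//.
  by rewrite -subSn// subSS leq_subr subKn// ltnW.
apply: (@mutually_independent_indep_seq _ _ _ _ (N + n) D Z phi).
- exact: bm_independent_increments ttm.
- by move=> j; rewrite /phi; case: ifP => _; [exact: measurable_funB|exact: measurable_funB].
- by move=> j w; rewrite /Z /phi; case: ifP.
- rewrite /r cat_uniq; apply/and3P; split.
  + by rewrite map_inj_uniq ?iota_uniq//; exact: addnI.
  + apply/hasPn => x /mapP[i]; rewrite mem_iota add0n => /= iN ->.
    apply/negP => /mapP[j _ E].
    by have := ltn_subrL i.+1 N; rewrite E ltnNge leq_addr/= (leq_ltn_trans (leq0n i) iN).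
  + rewrite map_inj_in_uniq ?iota_uniq// => i j; rewrite !mem_iota !add0n => /= iN jN E.
    by move/eqP: E; rewrite eqn_sub2lE// => /eqP[].
- rewrite /r all_cat; apply/andP; split; apply/allP => x /mapP[i];
    rewrite mem_iota add0n /= => iN ->.
    by rewrite ltn_add2l.
  by rewrite (leq_trans _ (leq_addr _ _))// ltn_subrL (leq_ltn_trans (leq0n i) iN).
Qed.

End brownian_grid.

Section grid_bounds.
Context d (T : measurableType d) (R : realType) (P : probability T R).
Variables (B : R -> {RV P >-> R}) (hB : two_sided_brownian_motion B).
Notation law := (distribution P).
Implicit Types (h k e u x : R).

Definition past_max h N : {mfun T >-> R} :=
  lindley [seq past_step B h i | i <- iota 0 N].

Definition future_max k n : {mfun T >-> R} :=
  lindley [seq future_step B k i | i <- iota 0 n].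

Lemma indep_future k n : 0 < k -> indep_seq P [seq future_step B k i | i <- iota 0 n].
Proof. by move=> k0; have := @indep_future_past _ _ _ _ _ hB k k 0 n k0 k0; rewrite cats0. Qed.

Lemma indep_past h N : 0 < h -> indep_seq P [seq past_step B h i | i <- iota 0 N].
Proof. by move=> h0; exact: (@indep_future_past _ _ _ _ _ hB h h N 0 h0 h0). Qed.

(** The sum of a nonempty suffix is again normal with equal mean and variance, so the reflection
    argument applies to each suffix; the empty one reduces to the sign of g. *)
Lemma signed_means_future k n : 0 < k ->
  signed_means P [seq future_step B k i | i <- iota 0 n].
Proof.
move=> k0 j x; rewrite -map_drop drop_iota add0n.
have [->|m0] := posnP (n - j).
  rewrite mean_odd_step_nil !lee_fin; split; last exact: odd_step_le1.
  rewrite le_eqVlt => /predU1P[<-|x0]; first by rewrite odd_step0.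
  by rewrite odd_step_gt0//; lra.
set m := (n - j)%N in m0 *; set s := map _ _.
have mk0 : 0 < m%:R * k by rewrite mulr_gt0// ltr0n.
have mO := measurable_odd_stepB x.
have -> : mean_odd_step P s x =
    (\int[normal_prob (m%:R * k)%R (Num.sqrt (m%:R * k))]_y (odd_step (x - y))%:E)%E.
  transitivity (\int[law (walk_sum s)]_y (odd_step (x - y))%:E)%E.
    rewrite ge0_integral_pushforward//; first by apply/measurable_EFinP.
    by move=> y _; rewrite lee_fin odd_step_ge0.
  apply: ge0_integral_measurableTypeR.
  - by apply/measurable_EFinP.
  - by move=> y; rewrite lee_fin odd_step_ge0.
  - by move=> A mA; apply: (law_future_sum hB).
by split=> x0; [exact: odd_step_normal_ge1|exact: odd_step_normal_le1].
Qed.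

Lemma future_max_ge k n : 0 < k -> (0 < n)%N ->
  ((mean_exp_max (n%:R * k))%:E <=
   \int[P]_w (expR (- (2 * future_max k n w)))%:E)%E.
Proof.
move=> k0 n0; apply: expectation_lindley_ge.
- by rewrite mulr_gt0// ltr0n.
- exact: indep_future.
- exact: signed_means_future.
- by move=> A mA; apply: (law_future_sum hB).
Qed.

Lemma future_max_le k n e : 0 < k -> (0 < n)%N -> 0 < e ->
  (1 + \int[P]_w (expR (- (2 * future_max k n w)))%:E <=
   (expR (2 * e) * (1 + mean_exp_max (n%:R * k))
    + n%:R * expR (e - e ^+ 2 / (k *+ 2)))%:E)%E.
Proof.
move=> k0 n0 e0; have s0 : Num.sqrt k != 0 by rewrite sqrtr_eq0 -ltNge.
rewrite -[n in n%:R * expR (e - _)](size_iota 0 n) -(size_map (future_step B k)).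
apply: expectation_lindley_le => //.
- by rewrite mulr_gt0// ltr0n.
- exact: indep_future.
- exact: signed_means_future.
- move=> _ /mapP[i _ ->]; rewrite (law_future_step hB)//.
  (* With [a = 0] the tilted tail bound is a plain bound on the probability of a step beyond [e]. *)
  have := integral_normal_expR_tail k 0 s0 e0.
  rewrite sqr_sqrtr ?(ltW k0)// (_ : 0 * k + _ + _ - _ = e - e ^+ 2 / (k *+ 2)); last first.
    by field; rewrite gt_eqF.
  apply: le_trans.
  under eq_integral do rewrite mul0r expR0 mul1e.
  by rewrite integral_indic// setIT.
- by move=> A mA; apply: (law_future_sum hB).
Qed.

Let integral_past_step h i (f : R -> \bar R) : 0 < h ->
  measurable_fun [set: R] f -> (forall x, 0 <= f x)%E ->
  (\int[law (past_step B h i)]_x f x = \int[normal_prob (- h) (Num.sqrt h)]_x f x)%E.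
Proof.
move=> h0 mf f0; apply: ge0_integral_measurableTypeR => //.
by move=> A mA; apply: (law_past_step hB).
Qed.

Let integral_past_step_expR h i a : 0 < h ->
  (\int[law (past_step B h i)]_y (expR (a * y))%:E =
   (expR ((a ^+ 2 / 2 - a) * h))%:E)%E.
Proof.
move=> h0; have s0 : Num.sqrt h != 0 by rewrite sqrtr_eq0 -ltNge.
rewrite integral_past_step//; last by apply/measurable_EFinP; exact: measurable_expRM.
rewrite integral_normal_expR// sqr_sqrtr ?(ltW h0)//; congr (expR _)%:E; by field.
Qed.

Lemma past_max_tail_le h N x : 0 < h ->
  (@ccdf _ _ _ P (past_max h N) x <= (expR (- (2 * x)))%:E)%E.
Proof.
move=> h0; apply: ccdf_lindley_le; first exact: indep_past.
move=> _ /mapP[i _ ->]; rewrite integral_past_step_expR//.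
by rewrite (_ : 2 ^+ 2 / 2 - 2 = 0) ?mul0r ?expR0//; field.
Qed.

(** A past step has exponential moment exp((a^2/2 - a)h), which is 1 at a = 2 and smallest,
    exp(-h/2), at a = 1; the latter gives the geometric term for the finite horizon. Weighting by
    exp(2y) reverses the drift of a step, so the overshoot term has the same form as for the future
    walk. *)
Lemma past_max_tail_ge h N e x : 0 < h -> 0 < e -> 0 <= x ->
  ((expR (- (2 * (x + e))))%:E <= @ccdf _ _ _ P (past_max h N) x
    + (expR (- (h / 2)) ^+ N + N%:R * expR (e - e ^+ 2 / (h *+ 2)))%:E)%E.
Proof.
move=> h0 e0 x0; have s0 : Num.sqrt h != 0 by rewrite sqrtr_eq0 -ltNge.
have := @ccdf_lindley_ge _ _ _ P [seq past_step B h i | i <- iota 0 N] x e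
  (expR (- (h / 2))) (expR (e - e ^+ 2 / (h *+ 2))) x0 (ltW e0) (expR_ge0 _)
  (expR_ge0 _) (@indep_past h N h0).
rewrite size_map size_iota => H; apply: (le_trans (H _ _ _)).
- move=> _ /mapP[i _ ->]; rewrite integral_past_step_expR//.
  by rewrite (_ : 2 ^+ 2 / 2 - 2 = 0) ?mul0r ?expR0//; field.
- move=> _ /mapP[i _ ->]; rewrite integral_past_step_expR// lee_fin ler_expR.
  by rewrite (_ : (1 ^+ 2 / 2 - 1) * h = - (h / 2))//; field.
- move=> _ /mapP[i _ ->]; rewrite integral_past_step//; last first.
    apply: emeasurable_funM; first by apply/measurable_EFinP; exact: measurable_expRM.
    by apply/measurable_EFinP; exact: measurable_indic.
  have := integral_normal_expR_tail (- h) 2 s0 e0.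
  rewrite sqr_sqrtr ?(ltW h0)//; congr (_ <= (expR _)%:E)%E.
  by field; rewrite gt_eqF.
rewrite leeD2l// lee_fin lerD2r ler_piMr ?exprn_ge0 ?expR_ge0//.
by rewrite -[leRHS]expR0 ler_expR; lra.
Qed.

Let indep_max h k N n : 0 < h -> 0 < k ->
  indep_seq P [:: future_max k n; past_max h N].
Proof.
move=> h0 k0; have H := @indep_future_past _ _ _ _ _ hB h k N n h0 k0.
have := @indep_seq_lindley _ _ _ P [::] _ _ H; rewrite cat0s => {}H.
by apply: (@indep_seq_lindley _ _ _ P [:: future_max k n] _ [::]); rewrite cats0.
Qed.

Lemma grid_gap_le h k N n u : 0 < h -> 0 < k ->
  (P [set w | (u + future_max k n w < past_max h N w)%R] <=
   (expR (- (2 * u)))%:E * \int[P]_w (expR (- (2 * future_max k n w)))%:E)%E.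
Proof.
move=> h0 k0; apply: gap_prob_le; first exact: indep_max.
by move=> x; exact: past_max_tail_le.
Qed.

Lemma grid_gap_ge h k N n u e : 0 < h -> 0 < k -> 0 < e -> 0 <= u ->
  ((expR (- (2 * (u + e))))%:E * \int[P]_w (expR (- (2 * future_max k n w)))%:E <=
   P [set w | (u + future_max k n w < past_max h N w)%R] +
   (expR (- (h / 2)) ^+ N + N%:R * expR (e - e ^+ 2 / (h *+ 2)))%:E)%E.
Proof.
move=> h0 k0 e0 u0; apply: gap_prob_ge => //.
- by move=> w; exact: lindley_ge0.
- exact: indep_max.
- by move=> x; exact: past_max_tail_ge.
Qed.

End grid_bounds.

Section lindley_prefix.
Context d (T : measurableType d) (R : realType).
Variables (X : nat -> {mfun T >-> R}) (f : nat -> T -> R) (w : T).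
Hypothesis XE : forall i, X i w = f i.+1 w - f i w.

Let lindleyS a n : lindley [seq X i | i <- iota a n.+1] w =
  Num.max 0 (f a.+1 w - f a w + lindley [seq X i | i <- iota a.+1 n] w).
Proof. by rewrite -XE. Qed.

Lemma lindley_prefix_le a n j : (j <= n)%N ->
  f (a + j)%N w - f a w <= lindley [seq X i | i <- iota a n] w.
Proof.
elim: n a j => [|n IH] a j; first by rewrite leqn0 => /eqP ->; rewrite addn0 subrr.
rewrite lindleyS le_max; case: j => [_|j jn].
  by rewrite addn0 subrr lexx.
apply/orP; right; rewrite addnS -addSn.
by have := IH a.+1 j jn; lra.
Qed.

Lemma lindley_prefix_attained a n : exists2 j, (j <= n)%N &
  lindley [seq X i | i <- iota a n] w = f (a + j)%N w - f a w.
Proof.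
elim: n a => [|n IH] a; first by exists 0%N => //; rewrite addn0 subrr.
rewrite lindleyS; have [j jn ->] := IH a.+1.
have [h|h] := leP 0 (f a.+1 w - f a w + (f (a.+1 + j)%N w - f a.+1 w)).
  by exists j.+1 => //; rewrite addnS addSn; ring.
by exists 0%N => //; rewrite addn0 subrr.
Qed.

End lindley_prefix.

(** * From grids to paths *)

Section paths.
Context (R : realType).
Implicit Types (y : R -> R) (t u v r s : R).

(** One index both extends the horizon to [m] and halves the mesh, so these nested grids exhaust a
    dense subset of the negative half-line. *)
Definition past_grid (m : nat) : set R :=
  [set - (j%:R * (2 ^+ m)^-1) | j in [set j | (j <= m * 2 ^ m)%N]].

Definition future_grid t (m : nat) : set R :=
  [set k%:R * (t / 2 ^+ m) | k in [set k | (k <= 2 ^ m)%N]].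

Lemma past_grid_le m n : (m <= n)%N -> past_grid m `<=` past_grid n.
Proof.
move=> /subnK <-; move: (n - m)%N => {}n.
elim: n => // n IH r /IH [j /= jm <-]; exists (2 * j)%N => /=.
  rewrite addSn expnS mulnCA leq_mul2l /= (leq_trans jm)//.
  by rewrite leq_mul2r leqnSn orbT.
by rewrite addSn exprS natrM invfM; congr (- _); field; rewrite expf_neq0.
Qed.

Lemma future_grid_le t m n : (m <= n)%N -> future_grid t m `<=` future_grid t n.
Proof.
move=> /subnK <-; move: (n - m)%N => {}n.
elim: n => // n IH r /IH [j /= jm <-]; exists (2 * j)%N => /=.
  by rewrite addSn expnS leq_mul2l.
by rewrite addSn exprS natrM; field; rewrite expf_neq0.
Qed.

Lemma past_grid_le0 m r : past_grid m r -> r <= 0.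
Proof. by move=> [j _ <-]; rewrite oppr_le0 mulr_ge0. Qed.

Lemma future_grid_itv t m s : 0 <= t -> future_grid t m s -> s \in `[0, t].
Proof.
move=> t0 [k /= km <-]; rewrite in_itv/= mulr_ge0 ?divr_ge0//=.
by rewrite mulrCA ler_piMr// ler_pdivrMr ?exprn_gt0// mul1r -natrX ler_nat.
Qed.

Lemma exp2_small (e : R) : 0 < e -> exists m0 : nat, forall m, (m0 <= m)%N -> (2 ^+ m)^-1 < e.
Proof.
move=> e0; exists (Num.truncn e^-1) => m mm.
rewrite invf_plt ?posrE ?exprn_gt0//; apply: (lt_le_trans (truncnS_gt _)).
by rewrite -natrX ler_nat (leq_ltn_trans mm)// ltn_expl.
Qed.

(** The claim covers all large [m] because [m] will also have to make the margin [m.+1%:R^-1]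
    small. *)
Lemma past_grid_dense r (e : R) : r <= 0 -> 0 < e ->
  exists m0 : nat, forall m, (m0 <= m)%N -> exists2 z, past_grid m z & `|z - r| < e.
Proof.
move=> r0 e0; have [m1 m1P] := exp2_small e0.
exists (maxn m1 (Num.truncn (- r)).+1) => m; rewrite geq_max => /andP[/m1P me rm].
have x0 : 0 <= - r * 2 ^+ m by rewrite mulr_ge0 ?oppr_ge0 ?exprn_ge0.
have /andP[jl jr] := truncn_itv x0.
have p0 : 0 < 2 ^+ m :> R by rewrite exprn_gt0.
exists (- ((Num.truncn (- r * 2 ^+ m))%:R * (2 ^+ m)^-1)).
  eexists; last by reflexivity.
  rewrite /= -(ler_nat R) (le_trans jl)// natrM natrX ler_wpM2r ?(ltW p0)//.
  by rewrite (le_trans (ltW (truncnS_gt _)))// ler_nat.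
set j := Num.truncn _ in jl jr *.
have jl' : j%:R / 2 ^+ m <= - r by rewrite ler_pdivrMr.
have jr' : - r < j%:R / 2 ^+ m + (2 ^+ m)^-1.
  by rewrite -[X in _ < _ + X]mul1r -mulrDl ltr_pdivlMr// natr1.
rewrite ltr_norml; apply/andP; split; lra.
Qed.

Lemma future_grid_dense t s (e : R) : 0 < t -> s \in `[0, t] -> 0 < e ->
  exists m, exists2 z, future_grid t m z & `|z - s| < e.
Proof.
move=> t0; rewrite in_itv/= => /andP[s0 st] e0.
have [m /(_ m (leqnn m)) me] := exp2_small (divr_gt0 e0 t0).
have x0 : 0 <= s / t * 2 ^+ m by rewrite mulr_ge0 ?exprn_ge0 ?divr_ge0 ?(ltW t0).
have /andP[jl jr] := truncn_itv x0.
have p0 : 0 < 2 ^+ m :> R by rewrite exprn_gt0.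
exists m, ((Num.truncn (s / t * 2 ^+ m))%:R * (t / 2 ^+ m)).
  eexists; last by reflexivity.
  rewrite /= -(ler_nat R) (le_trans jl)// natrX ler_piMl ?(ltW p0)//.
  by rewrite ler_pdivrMr// mul1r.
set j := Num.truncn _ in jl jr *.
have jE : j%:R * (t / 2 ^+ m) = j%:R / 2 ^+ m * t by rewrite mulrA mulrAC.
have jl' : j%:R / 2 ^+ m * t <= s by rewrite -ler_pdivlMr// ler_pdivrMr.
have jr' : s < j%:R / 2 ^+ m * t + (2 ^+ m)^-1 * t.
  rewrite -mulrDl -ltr_pdivrMr// -[X in _ < _ + X]mul1r -mulrDl.
  by rewrite ltr_pdivlMr// natr1.
have : (2 ^+ m)^-1 * t < e by rewrite -ltr_pdivlMr.
rewrite jE ltr_norml => ?; apply/andP; split; lra.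
Qed.

(** A past time that works where [y] is smallest on [0, t] works on all of [0, t], which puts the
    choice of [r] before the quantifier over future times. The margin compensates for the strictness
    lost when density extends the inequality from the grids to [0, t]. *)
Lemma reflected_min_gtP y t u : continuous y -> 0 < t -> 0 < u ->
  (u%:E < ereal_inf [set ereal_sup [set (y s - y r)%:E | r in `]-oo, s]]
                    | s in `[0%R, t]])%E <->
  exists m, exists2 r, past_grid m r &
    forall n s, future_grid t n s -> u + m.+1%:R^-1 < y s - y r.
Proof.
move=> cy t0 u0; split.
  move=> uinf; have [s0 s0t s0min] := EVT_min (ltW t0) (continuous_subspaceT cy).
  have : (u%:E < ereal_sup [set (y s0 - y r)%:E | r in `]-oo, s0]])%E.
    by apply: (lt_le_trans uinf); apply: ereal_inf_lbound; exists s0.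
  move=> /ereal_sup_gt[_ [r /= rs0 <-]]; rewrite lte_fin => ur.
  have r0 : r <= 0.
    rewrite leNgt; apply/negP => r0.
    have : y s0 <= y r.
      apply: s0min; rewrite in_itv/= (ltW r0)/=; move: rs0 s0t; rewrite !in_itv/= => rs0 /andP[_].
      exact: le_trans.
    by lra.
  (* Half of the slack pays for moving [r] to the grid, the other half for the margin. *)
  pose eta := (y s0 - y r - u) / 2.
  have eta0 : 0 < eta by rewrite /eta; lra.
  have /cvgrPdist_lt /(_ _ eta0) := cy r.
  rewrite -nbhs_ballE => -[de /= de0 H].
  have [m0 m0P] := past_grid_dense r0 de0.
  pose m := maxn m0 (Num.truncn eta^-1).
  have [z zm zr] := m0P m (leq_maxl _ _).
  exists m, z => // n s /(future_grid_itv (ltW t0)) /s0min ss0.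
  have := H z; rewrite /ball/= distrC => /(_ zr); rewrite ltr_norml => /andP[yz _].
  have : m.+1%:R^-1 <= eta.
    rewrite invf_ple ?posrE ?ltr0n// (le_trans (ltW (truncnS_gt _)))// ler_nat ltnS.
    exact: leq_maxr.
  by move: m.+1%:R^-1 => i; rewrite /eta in yz *; lra.
move=> [m [r rm H]]; have r0 := past_grid_le0 rm.
apply: (@lt_le_trans _ _ (u + m.+1%:R^-1)%:E).
  by rewrite lte_fin ltrDl invr_gt0 ltr0n.
apply: le_ereal_inf_tmp => _ [s st <-].
apply: (@le_trans _ _ (y s - y r)%:E); last first.
  apply: ereal_sup_ubound; exists r => //=; rewrite in_itv/=.
  by move: st; rewrite /= in_itv/= => /andP[s0 _]; exact: le_trans s0.
(* By continuity a violation at [s] would persist at a nearby point of some future grid. *)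
rewrite lee_fin leNgt; apply/negP => lt.
move: (m.+1%:R^-1) H lt => i H lt.
pose eta := u + i - (y s - y r).
have eta0 : 0 < eta by rewrite /eta; lra.
have /cvgrPdist_lt /(_ _ eta0) := cy s.
rewrite -nbhs_ballE => -[de /= de0 Hde].
have [n [z zn zs]] := future_grid_dense t0 st de0.
have := Hde z; rewrite /ball/= distrC => /(_ zs); rewrite ltr_norml => /andP[yz _].
by have := H n z zn; rewrite /eta in yz; lra.
Qed.

End paths.

Section dyadic.
Context d (T : measurableType d) (R : realType) (P : probability T R).
Variables (B : R -> {RV P >-> R}) (hB : two_sided_brownian_motion B).
Variables (t : R) (t0 : 0 < t).
Implicit Types (e u v x : R) (w : T).

Definition dyadic_past m : {mfun T >-> R} := past_max B (2 ^+ m)^-1 (m * 2 ^ m).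
Definition dyadic_future n : {mfun T >-> R} := future_max B (t / 2 ^+ n) (2 ^ n).

Let drifted0 w : drifted B 0 w = 0.
Proof. by rewrite /drifted (bm_start hB) subr0. Qed.

Lemma dyadic_past_ge m w r : past_grid m r -> - drifted B r w <= dyadic_past m w.
Proof.
move=> [j /= jm <-].
have := @lindley_prefix_le _ _ _ (past_step B (2 ^+ m)^-1)
  (fun i w => - drifted B (- (i%:R * (2 ^+ m)^-1)) w) w
  (fun i => past_stepE B _ i w) 0 _ _ jm.
by rewrite add0n mul0r oppr0 drifted0 oppr0 subr0.
Qed.

Lemma dyadic_past_attained m w :
  exists2 r, past_grid m r & dyadic_past m w = - drifted B r w.
Proof.
have [j jm E] := @lindley_prefix_attained _ _ _ (past_step B (2 ^+ m)^-1)
  (fun i w => - drifted B (- (i%:R * (2 ^+ m)^-1)) w) w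
  (fun i => past_stepE B _ i w) 0 (m * 2 ^ m).
exists (- (j%:R * (2 ^+ m)^-1)); first by exists j.
by rewrite /dyadic_past [LHS]E add0n mul0r oppr0 drifted0 oppr0 subr0.
Qed.

Lemma dyadic_future_ge n w s : future_grid t n s -> - drifted B s w <= dyadic_future n w.
Proof.
move=> [j /= jm <-].
have := @lindley_prefix_le _ _ _ (future_step B (t / 2 ^+ n))
  (fun i w => - drifted B (i%:R * (t / 2 ^+ n)) w) w
  (fun i => future_stepE B _ i w) 0 _ _ jm.
by rewrite add0n mul0r drifted0 oppr0 subr0.
Qed.

Lemma dyadic_future_attained n w :
  exists2 s, future_grid t n s & dyadic_future n w = - drifted B s w.
Proof.
have [j jm E] := @lindley_prefix_attained _ _ _ (future_step B (t / 2 ^+ n))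
  (fun i w => - drifted B (i%:R * (t / 2 ^+ n)) w) w
  (fun i => future_stepE B _ i w) 0 (2 ^ n).
exists (j%:R * (t / 2 ^+ n)); first by exists j.
by rewrite /dyadic_future [LHS]E add0n mul0r drifted0 oppr0 subr0.
Qed.

Lemma dyadic_past_le m n w : (m <= n)%N -> dyadic_past m w <= dyadic_past n w.
Proof.
move=> mn; have [r rm ->] := dyadic_past_attained m w.
exact/dyadic_past_ge/(past_grid_le mn).
Qed.

Lemma dyadic_future_le m n w : (m <= n)%N -> dyadic_future m w <= dyadic_future n w.
Proof.
move=> mn; have [r rm ->] := dyadic_future_attained m w.
exact/dyadic_future_ge/(future_grid_le mn).
Qed.

(** The margin shrinks as [m] grows, which makes the intersections over [n] increase with [m]; both
    limits of probabilities are then monotone. *)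
Definition dyadic_gap u m n : set T :=
  [set w | u + m.+1%:R^-1 + dyadic_future n w < dyadic_past m w].

Lemma measurable_dyadic_gap u m n : measurable (dyadic_gap u m n).
Proof.
have := @measurable_funB _ T R setT (dyadic_past m) (dyadic_future n).
move=> /(_ _ _ measurableT `]u + m.+1%:R^-1, +oo[%classic (measurable_itv _)).
rewrite setTI => H; rewrite (_ : dyadic_gap _ _ _ =
   (dyadic_past m \- dyadic_future n) @^-1` `]u + m.+1%:R^-1, +oo[%classic); first exact: H.
by apply/seteqP; split => w; rewrite /dyadic_gap/= in_itv/= andbT ltrBrDr.
Qed.

Lemma dyadic_gap_nonincreasing u m : nonincreasing_seq (dyadic_gap u m).
Proof.
move=> n1 n2 n12; apply/subsetPset => w; rewrite /dyadic_gap/=.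
by apply: le_lt_trans; rewrite lerD2l dyadic_future_le.
Qed.

Lemma bigcap_dyadic_gap_nondecreasing u :
  nondecreasing_seq (fun m => \bigcap_n dyadic_gap u m n).
Proof.
move=> m1 m2 m12; apply/subsetPset => w H n _; have := H n I; rewrite /dyadic_gap/=.
move=> h; apply: (@le_lt_trans _ _ (u + m1.+1%:R^-1 + dyadic_future n w)).
  by rewrite lerD2r lerD2l lef_pV2 ?posrE ?ltr0n// ler_nat ltnS.
by apply: (lt_le_trans h); exact: dyadic_past_le.
Qed.

Lemma reflected_min_dyadic u : 0 < u ->
  [set w | (u%:E < reflected_min B t w)%E] = \bigcup_m \bigcap_n dyadic_gap u m n.
Proof.
move=> u0; apply/seteqP; split => w /=.
  have cy : continuous (fun s => drifted B s w).
    move=> s; apply: cvgB; last exact: cvg_id.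
    exact: (bm_continuous_paths hB).
  move=> /(reflected_min_gtP cy t0 u0)[m [r rm H]]; exists m => // n _.
  have [s sn E] := dyadic_future_attained n w; rewrite /dyadic_gap/= E.
  by have := H n s sn; have := dyadic_past_ge w rm; move: (m.+1%:R^-1) => i; lra.
have cy : continuous (fun s => drifted B s w).
  move=> s; apply: cvgB; last exact: cvg_id.
  exact: (bm_continuous_paths hB).
move=> [m _ H]; apply/(reflected_min_gtP cy t0 u0); exists m.
have [r rm E] := dyadic_past_attained m w; exists r => // n s sn.
have := H n I; have := dyadic_future_ge w sn; rewrite /dyadic_gap/= E.
by move: (m.+1%:R^-1) => i; lra.
Qed.

End dyadic.

(** * Passage to the limit along the grids *)

Section limits.
Context {R : realType}.
Implicit Types (a c e p x : R).

Lemma ge_at_right0 (F : R -> R) p : {for 0, continuous F} ->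
  (forall e, 0 < e -> p <= F e) -> p <= F 0.
Proof.
move=> cF H; have FR : F e @[e --> 0^'+] --> F 0 by exact: cvg_at_right_filter.
apply: (ler_cvg_to (cvg_cst p) FR); near=> e; apply: H; near: e.
exact: nbhs_right_gt.
Unshelve. all: by end_near. Qed.

Lemma le_at_right0 (F : R -> R) p : {for 0, continuous F} ->
  (forall e, 0 < e -> F e <= p) -> F 0 <= p.
Proof.
move=> cF H; have FR : F e @[e --> 0^'+] --> F 0 by exact: cvg_at_right_filter.
apply: (ler_cvg_to FR (cvg_cst p)); near=> e; apply: H; near: e.
exact: nbhs_right_gt.
Unshelve. all: by end_near. Qed.

(** The constant is 3^3, from exp(y) = exp(y/3)^3 >= (y/3)^3; a cubic bound leaves a decay of order
    1/x after the factor [x ^+ 2]. *)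
Lemma sqr_mul_expRN_le c x : 0 < c -> 0 < x ->
  x ^+ 2 * expR (- (c * x)) <= 27 / c ^+ 3 * x^-1.
Proof.
move=> c0 x0; have y0 : 0 < c * x / 3 by rewrite divr_gt0 ?mulr_gt0.
have h : (c * x / 3) ^+ 3 <= expR (c * x).
  have -> : expR (c * x) = expR (c * x / 3) ^+ 3.
    by rewrite -expRM_natr divfK// pnatr_eq0.
  rewrite lerXn2r ?nnegrE ?expR_ge0 ?(ltW y0)//.
  by apply: le_trans (expR_ge1Dx _); rewrite lerDr.
rewrite expRN ler_pdivrMr ?expR_gt0//.
apply: (@le_trans _ _ (27 / c ^+ 3 * x^-1 * (c * x / 3) ^+ 3)); last first.
  by rewrite ler_wpM2l// !mulr_ge0 ?invr_ge0 ?exprn_ge0 ?ltW.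
rewrite [leRHS](_ : _ = x ^+ 2)//; field.
by rewrite !gt_eqF.
Qed.

(** The square dominates both step counts, [2 ^ n] for the future grid and [m * 2 ^ m] for the past
    one. *)
Lemma cvg_pow2_expRN a c : 0 < c ->
  (2 ^+ m) ^+ 2 * expR (a - c * 2 ^+ m) @[m --> \oo] --> (0 : R).
Proof.
move=> c0; pose K := expR a * (27 / c ^+ 3).
have : K * 2^-1 ^+ m @[m --> \oo] --> (0 : R).
  rewrite -[X in _ --> X](mulr0 K); apply: cvgM; first exact: cvg_cst.
  by apply: cvg_expr; rewrite ger0_norm// invf_lt1 ?ltr1n.
apply: (squeeze_cvgr _ (cvg_cst 0)); near=> m.
rewrite mulr_ge0 ?expR_ge0 ?exprn_ge0//= expRD mulrCA exprVn /K -[leRHS]mulrA.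
by rewrite ler_wpM2l ?expR_ge0// sqr_mul_expRN_le// exprn_gt0.
Unshelve. all: by end_near. Qed.

End limits.

Section final.
Context d (T : measurableType d) (R : realType) (P : probability T R).
Variables (B : R -> {RV P >-> R}) (hB : two_sided_brownian_motion B).
Variables (t u : R) (t0 : 0 < t) (u0 : 0 < u).
Implicit Types (e : R).

Let C := mean_exp_max t.
Let S := [set w | (u%:E < reflected_min B t w)%E].
Let p := fine (P S).

Let mesh n : (2 ^ n)%:R * (t / 2 ^+ n) = t.
Proof. by rewrite natrX mulrCA divff ?mulr1// expf_neq0. Qed.

Let mG m : measurable (\bigcap_n dyadic_gap B t u m n).
Proof. by apply: bigcapT_measurable => n; exact: measurable_dyadic_gap. Qed.

Let SE : S = \bigcup_m \bigcap_n dyadic_gap B t u m n.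
Proof. exact: reflected_min_dyadic. Qed.

Let mS : measurable S.
Proof. by rewrite SE; apply: bigcupT_measurable. Qed.

Let PS : P S = p%:E.
Proof. by rewrite fineK// fin_num_measure. Qed.

Let K n := (\int[P]_w (expR (- (2 * dyadic_future B t n w)))%:E)%E.

Let K_ge n : (C%:E <= K n)%E.
Proof.
have := future_max_ge hB (k := t / 2 ^+ n) (n := 2 ^ n).
by rewrite mesh; apply; rewrite ?expn_gt0// divr_gt0// exprn_gt0.
Qed.

Let K_le n e : 0 < e ->
  (1 + K n <= (expR (2 * e) * (1 + C)
     + 2 ^+ n * expR (e - e ^+ 2 / (t *+ 2) * 2 ^+ n))%:E)%E.
Proof.
move=> e0; have := future_max_le hB (k := t / 2 ^+ n) (n := 2 ^ n) (e := e).
rewrite mesh natrX => /(_ _ _ e0); rewrite (_ : e - _ = e - e ^+ 2 / (t *+ 2) * 2 ^+ n).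
  by apply; rewrite ?expn_gt0// divr_gt0// exprn_gt0.
by field; rewrite gt_eqF// expf_neq0.
Qed.

(** The upper bound on the past tail has no error term and the margin only helps, so a fixed future
    grid already bounds the limit over [m]. *)
Let p_le n : (p%:E <= (expR (- (2 * u)))%:E * K n)%E.
Proof.
rewrite -PS SE.
have H := @nondecreasing_cvg_mu _ _ _ P _ mG.
have {}H := H _ (@bigcap_dyadic_gap_nondecreasing _ _ _ _ _ hB _ u).
rewrite -SE in H *; have {}H := H mS.
rewrite -(cvg_lim _ H)//; apply: lime_le; first by apply/cvg_ex; exists (P S).
near=> m; rewrite /=.
apply: (@le_trans _ _ (P (dyadic_gap B t u m n))).
  by apply: le_measure; rewrite ?inE//; [exact: measurable_dyadic_gap|exact: bigcap_inf].
apply: (le_trans (grid_gap_le hB _ _ _ _ _)).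
- by rewrite invr_gt0 exprn_gt0.
- by rewrite divr_gt0 ?exprn_gt0.
apply: lee_wpmul2r; first by apply: integral_ge0 => w _; rewrite lee_fin expR_ge0.
rewrite lee_fin ler_expR lerN2 ler_pM2l// lerDl.
by rewrite invr_ge0.
Unshelve. all: by end_near. Qed.

Let p_le_limit : p <= expR (- (2 * u)) * C.
Proof.
have Q0 : 0 < expR (- (2 * u)) by exact: expR_gt0.
(* This is the shape of [K_le] at [e = 0], to be reached as a limit from [0 < e]. *)
suff : p / expR (- (2 * u)) + 1 <= expR (2 * 0) * (1 + C).
  by rewrite mulr0 expR0 mul1r addrC lerD2l ler_pdivrMr// mulrC.
apply: (@ge_at_right0 _ (fun e => expR (2 * e) * (1 + C))).
  apply: cvgM; last exact: cvg_cst.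
  apply: (cvg_comp (fun e => 2 * e) (@expR R)); last exact: continuous_expR.
  by apply: cvgM; [exact: cvg_cst|exact: cvg_id].
move=> e e0.
have c0 : 0 < e ^+ 2 / (t *+ 2) by rewrite divr_gt0 ?exprn_gt0 ?pmulrn_lgt0.
have L : expR (2 * e) * (1 + C) + (2 ^+ n) ^+ 2 * expR (e - e ^+ 2 / (t *+ 2) * 2 ^+ n)
    @[n --> \oo] --> expR (2 * e) * (1 + C).
  rewrite -[X in _ --> X]addr0; apply: cvgD; first exact: cvg_cst.
  exact: cvg_pow2_expRN.
apply: (ler_cvg_to (cvg_cst _) L); near=> n.
have := le_trans (leeD2l 1%E _) (K_le n e0).
have -> : p / expR (- (2 * u)) + 1 = 1 + p / expR (- (2 * u)) by rewrite addrC.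
move=> /(_ (p / expR (- (2 * u)))%:E).
rewrite -EFinD lee_fin => H; apply: (le_trans (H _)).
  by rewrite EFinM lee_pdivrMr// muleC.
rewrite lerD2l ler_wpM2r ?expR_ge0// expr2 ler_peMl ?exprn_ge0//.
by rewrite -natrX ler1n expn_gt0.
Unshelve. all: by end_near. Qed.

(** The grid reaches back to time [- m], so the first term, the cost of the finite horizon, is
    exp(-m/2); the second is the cost of overshoots. *)
Let err e m := expR (- ((2 ^+ m)^-1 / 2)) ^+ (m * 2 ^ m)
  + (m * 2 ^ m)%:R * expR (e - e ^+ 2 / ((2 ^+ m)^-1 *+ 2)).

Let err_cvg0 e : 0 < e -> err e m @[m --> \oo] --> (0 : R).
Proof.
move=> e0; rewrite -[X in _ --> X]addr0; apply: cvgD.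
  have : expR (- 2^-1 : R) ^+ m @[m --> \oo] --> (0 : R).
    apply: cvg_expr; rewrite ger0_norm ?expR_ge0// -[ltRHS]expR0 ltr_expR; lra.
  apply: cvg_trans; apply: near_eq_cvg; near=> m.
  rewrite mulnC exprM; congr (_ ^+ m); rewrite -expRM_natl natrX; congr expR.
  by field; rewrite expf_neq0.
have c0 : 0 < e ^+ 2 / 2 by rewrite divr_gt0 ?exprn_gt0.
apply: (squeeze_cvgr _ (cvg_cst 0) (cvg_pow2_expRN e c0)); near=> m.
rewrite mulr_ge0 ?expR_ge0//=.
rewrite (_ : e - e ^+ 2 / ((2 ^+ m)^-1 *+ 2) = e - e ^+ 2 / 2 * 2 ^+ m); last first.
  by field; rewrite expf_neq0.
rewrite ler_wpM2r ?expR_ge0// natrM natrX expr2 ler_wpM2r ?exprn_ge0//.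
by rewrite -natrX ler_nat ltnW// ltn_expl.
Unshelve. all: by end_near. Qed.

(** [K_ge] holds at every [n] without error, so letting [n] tend to infinity costs nothing and only
    the error of the past grid remains. *)
Let p_ge m e : 0 < e ->
  expR (- (2 * (u + m.+1%:R^-1 + e))) * C <= p + err e m.
Proof.
move=> e0.
have H : P (\bigcap_n dyadic_gap B t u m n) \is a fin_num by exact: fin_num_measure.
apply: (@le_trans _ _ (fine (P (\bigcap_n dyadic_gap B t u m n)) + err e m)); last first.
  rewrite lerD2r fine_le ?fin_num_measure//; apply: le_measure; rewrite ?inE//.
  by rewrite SE => w Hw; exists m.
rewrite -lerBlDr -lee_fin fineK//.
have L := nonincreasing_cvg_mu (mu := P) _ (measurable_dyadic_gap B t u m) (mG m)
  (@dyadic_gap_nonincreasing _ _ _ _ _ hB _ u m).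
have P0y : (P (dyadic_gap B t u m 0) < +oo)%E.
  rewrite -ge0_fin_numE// fin_num_measure//; exact: measurable_dyadic_gap.
rewrite -(cvg_lim _ (L P0y))//.
apply: lime_ge; first by apply/cvg_ex; eexists; exact: L P0y.
near=> n; rewrite EFinB leeBlDr// EFinM.
apply: (@le_trans _ _ ((expR (- (2 * (u + m.+1%:R^-1 + e))))%:E * K n)%E).
  by apply: lee_wpmul2l; rewrite ?lee_fin ?expR_ge0.
have h0 : 0 < (2 ^+ m)^-1 :> R by rewrite invr_gt0 exprn_gt0.
have k0 : 0 < t / 2 ^+ n by rewrite divr_gt0 ?exprn_gt0.
have v0 : 0 <= u + m.+1%:R^-1 by rewrite addr_ge0 ?invr_ge0 ?(ltW u0).
exact: (grid_gap_ge hB (m * 2 ^ m) (2 ^ n) h0 k0 e0 v0).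
Unshelve. all: by end_near. Qed.

Let p_ge_limit : expR (- (2 * u)) * C <= p.
Proof.
rewrite -[in leLHS](addr0 u).
apply: (@le_at_right0 _ (fun e => expR (- (2 * (u + e))) * C)).
  apply: cvgM; last exact: cvg_cst.
  apply: (cvg_comp (fun e => - (2 * (u + e))) (@expR R)); last exact: continuous_expR.
  apply: cvgN; apply: cvgM; first exact: cvg_cst.
  by apply: cvgD; [exact: cvg_cst|exact: cvg_id].
move=> e e0.
(* The limit in [m] is taken at fixed [e], since [err e m] is known to vanish only for a fixed
   positive [e]. *)
have L1 : expR (- (2 * (u + m.+1%:R^-1 + e))) * C @[m --> \oo] -->
    expR (- (2 * (u + e))) * C.
  apply: cvgM; last exact: cvg_cst.
  apply: (cvg_comp (fun m : nat => - (2 * (u + m.+1%:R^-1 + e))) (@expR R));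
    last exact: continuous_expR.
  apply: cvgN; apply: cvgM; first exact: cvg_cst.
  apply: cvgD; last exact: cvg_cst.
  rewrite -[X in _ --> X]addr0; apply: cvgD; first exact: cvg_cst.
  exact: cvg_harmonic.
have L2 : p + err e m @[m --> \oo] --> p.
  rewrite -[X in _ --> X]addr0; apply: cvgD; first exact: cvg_cst.
  exact: err_cvg0.
by apply: (ler_cvg_to L1 L2); near=> m; exact: p_ge.
Unshelve. all: by end_near. Qed.

Lemma reflected_min_prob : P S = (expR (- (2 * u)) * C)%:E.
Proof. by rewrite PS; congr EFin; apply/eqP; rewrite eq_le p_le_limit p_ge_limit. Qed.

End final.

Theorem theorem3 (d : measure_display) (T : measurableType d) (R : realType)
    (P : probability T R) (B : R -> {RV P >-> R})
    (hB : two_sided_brownian_motion B) (t u : R) (ht : 0 < t) (hu : 0 < u) :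
  P [set w | (u%:E < reflected_min B t w)%E] =
    (expR (- (2 * u)) *
      (2 * (1 + t) * normal_tail (Num.sqrt t)
       - Num.sqrt (2 * t / pi) * expR (- t / 2)))%:E.
Proof. exact: reflected_min_prob. Qed.
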